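(* Let $\widetilde{W}/W\in\{\widetilde{C}_n/C_n,\widetilde{B}_n/B_n,\widetilde{B}_n/D_n,\widetilde{D}_n/D_n\}$, let $w\in\widetilde{W}/W$ and $\lambda=\mathcal{C}(w)$. Then $\mathcal{R}(\lambda)$ is a reduced expression for $w$, and the number of boxes in the upper diagram $U_\lambda$ equals the Coxeter length of $w$.
   Context: Groups. Let $N=2n+1$. A mirrored $\mathbb{Z}$-permutation is a bijection $w:\mathbb{Z}\to\mathbb{Z}$ with $w(i+N)=w(i)+N$ and $w(-i)=-w(i)$ for all $i\in\mathbb{Z}$; it is determined by $(w(1),\dots,w(n))$. Under composition these form the affine Coxeter group $\widetilde{C}_n$. Define elements by their images $(w(1),\dots,w(n))$: $s_i=(1,\dots,i-1,i+1,i,i+2,\dots,n)$ for $1\le i\le n-1$; $s_0^C=(-1,2,3,\dots,n)$; $s_0^D=(-2,-1,3,\dots,n)$; $s_n^C=(1,\dots,n-1,n+1)$; $s_n^D=(1,\dots,n-2,n+1,n+2)$. The four types are: - $\widetilde{C}/C$: $\widetilde{W}$ is all mirrored $\mathbb{Z}$-permutations, generators $s_0=s_0^C,s_1,\dots,s_{n-1},s_n=s_n^C$ ($n\ge2$). - $\widetilde{B}/B$: those with $|\{i\le0:w(i)\ge1\}|$ even, generators $s_0=s_0^D,s_1,\dots,s_{n-1},s_n=s_n^C$ ($n\ge3$). - $\widetilde{B}/D$: those with $|\{i\le n:w(i)\ge n+1\}|$ even, generators $s_0=s_0^C,s_1,\dots,s_{n-1},s_n=s_n^D$ ($n\ge3$).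 - $\widetilde{D}/D$: those satisfying both parity conditions, generators $s_0=s_0^D,s_1,\dots,s_{n-1},s_n=s_n^D$ ($n\ge4$). $W$ is generated by $s_1,\dots,s_n$, and $\widetilde{W}/W$ denotes the set of minimal length representatives of the cosets $wW$; $\widetilde{W}$ acts on it by left multiplication of cosets. Coxeter length and reduced expressions are with respect to $s_0,\dots,s_n$ of the given type. Abaci and cores. An abacus has runners (columns) $1,\dots,2n$; runner $i$ has entries labeled $mN+i$ for each level $m\in\mathbb{Z}$; some entries are beads, the others gaps; reading order is the order of labels; ''lowest'' means largest label; the abacus is flush if no bead is preceded by a gap on its runner. $\mathcal{A}(w)$ is the flush abacus whose lowest bead in each runner is an element of $\{w(1),\dots,w(2n)\}$. $\mathcal{C}(w)$ is the partition whose southeast boundary is the lattice path obtained by reading the entries of $\mathcal{A}(w)$ in reading order, recording a north-step for each bead and an east-step for each gap (first row at the top). $w\mapsto\mathcal{C}(w)$ is injective on $\widetilde{W}/W$, and $\widetilde{W}$ acts on its image by transport of structure. Residues. Entries of $\mathbb{N}^2$ are $(i,j)$ = (row, column); the $k$-th diagonal is $\{j-i=k\}$ and the main diagonal is $k=0$. Write $p\,\|\,q$ for the element of $\{0,\dots,q-1\}$ congruent to $p$ mod $q$. The fixed residue of $(i,j)$ is $(j-i)\|(2n)$ if this is $\le n$, and $2n-((j-i)\|(2n))$ otherwise. An escalator is a connected component of the cells with $(j-i)\|(2n)\in\{n-1,n,n+1\}$; a descalator is a connected component of the cells with $(j-i)\|(2n)\in\{0,1,2n-1\}$; upper means above the main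 diagonal, lower means below; the descalator containing the main diagonal is the main descalator. Given $\lambda$, let a row meet an upper escalator in cells $c_1,c_2,c_3$ (left to right): if the row of $\lambda$ ends immediately left of $c_1$, then $c_1$ has both residues $n-1,n$, $c_2$ has residue $n$, $c_3$ undefined; if it ends at $c_1$: residues $n-1,n,n$; if it ends at $c_2$: $n,n,n-1$; if it ends at $c_3$: $c_1$ undefined, $c_2$ has residue $n$, $c_3$ has both residues $n-1,n$; otherwise undefined. Upper descalators: the same rule with $n-1$ replaced by $1$ and $n$ by $0$. Lower escalators/descalators: transposed rule, column by column. Main descalator: residue $0$ if $i=j$; if $|i-j|=1$, residue $1$ when $i+j\equiv1$ mod $4$ and $0$ when $i+j\equiv3$ mod $4$. Type $\widetilde{C}/C$ uses fixed residues only; $\widetilde{B}/B$ uses the descalator rules on descalators; $\widetilde{B}/D$ uses the escalator rules on escalators; $\widetilde{D}/D$ uses both; all remaining cells have their fixed residue. Central peeling procedure. The reference diagonal is the main diagonal in types $\widetilde{C}/C,\widetilde{B}/D$ and the first diagonal in types $\widetilde{B}/B,\widetilde{D}/D$. Start with $\lambda^{(1)}=\lambda$. At step $i$ (while $\lambda^{(i)}$ is nonempty) let $d^{(i)}$ be the number of boxes of $\lambda^{(i)}$ on the reference diagonal, $B_i$ the box at the end of the $d^{(i)}$-th row of $\lambda^{(i)}$, and $r_i$ its residue; if $B_i$ is both $n$-removable and $(n-1)$-removable (has both residues), set $r_i=n$. Let $\lambda^{(i+1)}$ be the result of $s_{r_i}$ acting on $\lambda^{(i)}$. $\mathcal{R}(\lambda)$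 is the product $s_{r_1}s_{r_2}\cdots s_{r_\ell}$ over all steps. The upper diagram $U_\lambda$ is the set of boxes $B_i$ encountered, with the following conditions: in types $\widetilde{B}/D,\widetilde{D}/D$, an application of $s_n^D$ removes two boxes from row $d^{(i)}$ and the box not on the $n$-th diagonal is recorded; in types $\widetilde{B}/B,\widetilde{D}/D$, an application of $s_0^D$ removes two boxes from row $d^{(i)}$ and the box not on the main or $2n$-th diagonal is recorded. *)

(* Defs.v *)
From mathcomp Require Import all_boot all_order all_algebra.
From mathcomp Require Import zify.

Set Implicit Arguments.
Unset Strict Implicit.
Unset Printing Implicit Defensive.

Import Order.TTheory GRing.Theory Num.Theory.
Local Open Scope ring_scope.

(** * Mirrored Z-permutations and the groups *)

(* The quotients C~/C, B~/B, B~/D and D~/D. *)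
Inductive quotient_type := CC | BB | BD | DD.

Definition min_rank (ty : quotient_type) : nat :=
  match ty with CC => 2 | BB => 3 | BD => 3 | DD => 4 end.

(* s_0 is s_0^D (instead of s_0^C); s_n is s_n^D (instead of s_n^C). *)
Definition uses_s0D (ty : quotient_type) : bool :=
  match ty with BB | DD => true | _ => false end.
Definition uses_snD (ty : quotient_type) : bool :=
  match ty with BD | DD => true | _ => false end.

Definition period (n : nat) : nat := (2 * n).+1.

Definition mirrored (n : nat) (w : int -> int) : Prop :=
  [/\ bijective w,
      forall i, w (i + (period n)%:Z) = w i + (period n)%:Z
    & forall i, w (- i) = - w i].

Definition even_card (P : pred int) : Prop :=
  exists s : seq int, [/\ uniq s, s =i P & ~~ odd (size s)].

Definition affine_group (ty : quotient_type) (n : nat) (w : int -> int) : Prop :=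
  [/\ mirrored n w,
      uses_s0D ty -> even_card [pred i : int | (i <= 0) && (1 <= w i)]
    & uses_snD ty ->
        even_card [pred i : int | (i <= n%:Z) && (n.+1%:Z <= w i)]].

(* The mirrored Z-permutation with prescribed images f 1, ..., f n: for
   n < r < N = 2n + 1, the image of r = N - (N - r) is N - f (N - r). *)
Definition mirror_extend (n : nat) (f : nat -> int) (i : int) : int :=
  let N := (period n)%:Z in
  let q := (i %/ N)%Z in
  let r := `|(i %% N)%Z|%N in
  q * N + (if (r == 0)%N then 0
           else if (r <= n)%N then f r
           else N - f (period n - r)%N).

Definition gen_image (ty : quotient_type) (n r k : nat) : int :=
  if (r == 0)%N then
    if uses_s0D ty then
      if (k == 1)%N then - 2 else if (k == 2)%N then - 1 else k%:Z
    else if (k == 1)%N then - 1 else k%:Z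
  else if (r == n)%N then
    if uses_snD ty then
      if (k == n.-1)%N then n.+1%:Z else if (k == n)%N then n.+2%:Z else k%:Z
    else if (k == n)%N then n.+1%:Z else k%:Z
  else if (k == r)%N then r.+1%:Z else if (k == r.+1)%N then r%:Z else k%:Z.

Definition gen (ty : quotient_type) (n : nat) (r : 'I_n.+1) : int -> int :=
  mirror_extend n (gen_image ty n r).

(* The product s_(r_1) s_(r_2) ... s_(r_l), with (u v)(i) = u(v(i)). *)
Definition word_prod (ty : quotient_type) (n : nat) (rs : seq 'I_n.+1)
    : int -> int :=
  foldr (fun r u => gen ty r \o u) id rs.

Definition coxeter_length (ty : quotient_type) (n : nat) (w : int -> int)
    (l : nat) : Prop :=
  (exists2 rs : seq 'I_n.+1, word_prod ty rs =1 w & size rs = l) /\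
  (forall rs : seq 'I_n.+1, word_prod ty rs =1 w -> (l <= size rs)%N).

Definition reduced_expression (ty : quotient_type) (n : nat)
    (rs : seq 'I_n.+1) (w : int -> int) : Prop :=
  word_prod ty rs =1 w /\ coxeter_length ty n w (size rs).

(* The generators are involutions, so words suffice to generate. *)
Definition parabolic_group (ty : quotient_type) (n : nat) (x : int -> int)
    : Prop :=
  exists2 rs : seq 'I_n.+1, all (fun r : 'I_n.+1 => (0 < r)%N) rs
                          & word_prod ty rs =1 x.

Definition min_coset_rep (ty : quotient_type) (n : nat) (w : int -> int)
    : Prop :=
  affine_group ty n w /\
  forall x l l', parabolic_group ty n x ->
    coxeter_length ty n w l -> coxeter_length ty n (w \o x) l' -> (l <= l')%N.

Definition same_coset (ty : quotient_type) (n : nat) (u v : int -> int) : Prop :=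
  exists2 x, parabolic_group ty n x & u =1 v \o x.

(** * Abaci and cores *)

(* Multiples of the period label no entry of the abacus. *)
Definition entry (n : nat) (x : int) : bool := ~~ ((period n)%:Z %| x)%Z.

Definition bead (n : nat) (w : int -> int) (x : int) : bool :=
  entry n x &&
  has (fun j : nat => (w j%:Z == x %[mod (period n)%:Z])%Z && (x <= w j%:Z))
      (iota 1 (2 * n)).

(* Labels below - window n w are all beads and labels above window n w are all
   gaps; they contribute only to the two axes of the boundary path. *)
Definition window (n : nat) (w : int -> int) : nat :=
  \max_(1 <= j < (2 * n).+1) `|w j%:Z|%N.

Definition reading_order (n : nat) (w : int -> int) : seq int :=
  let M := window n w in
  [seq x <- [seq k%:Z - M%:Z | k <- iota 0 (2 * M).+1] | entry n x].

(* Row lengths, top row first, cut out by a lattice path read from its south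
   west end, starting in column c: true is a north step, false an east step. *)
Fixpoint path_rows (c : nat) (steps : seq bool) : seq nat :=
  match steps with
  | [::] => [::]
  | true :: steps' => rcons (path_rows c steps') c
  | false :: steps' => path_rows c.+1 steps'
  end.

(* Partitions are weakly decreasing sequences of positive row lengths. *)
Definition core (n : nat) (w : int -> int) : seq nat :=
  [seq l <- path_rows 0 [seq bead n w x | x <- reading_order n w] | (0 < l)%N].

Definition core_act (ty : quotient_type) (n : nat) (r : 'I_n.+1)
    (la mu : seq nat) : Prop :=
  exists u v : int -> int,
    [/\ min_coset_rep ty n u, min_coset_rep ty n v,
        core n u = la, core n v = mu & same_coset ty n (gen ty r \o u) v].

(** * Residues *)

(* (row, column), both counted from 1 *)
Definition cell : Type := (nat * nat)%type.

Definition row_len (la : seq nat) (i : nat) : nat := nth 0%N la i.-1.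
Definition col_len (la : seq nat) (j : nat) : nat :=
  count (fun l => (j <= l)%N) la.

Definition diag (c : cell) : int := c.2%:Z - c.1%:Z.
Definition diag_mod (n : nat) (c : cell) : nat :=
  `|(diag c %% (2 * n)%:Z)%Z|%N.

Definition fixed_residue (n : nat) (c : cell) : nat :=
  if (diag_mod n c <= n)%N then diag_mod n c else (2 * n - diag_mod n c)%N.

(* The band around m is the set of cells with diagonal congruent to m - 1, m or
   m + 1 modulo 2n; the escalators (m = n) and the descalators (m = 0) are its
   connected components, see [band_componentP]. A cell of an upper component is
   the (band_pos + 1)-st cell, from the left, in which its row meets that
   component. *)
Definition band_pos (n m : nat) (c : cell) : nat :=
  `|((diag c - m%:Z + 1) %% (2 * n)%:Z)%Z|%N.
Definition in_band (n m : nat) (c : cell) : bool :=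
  [&& (0 < c.1)%N, (0 < c.2)%N & (band_pos n m c < 3)%N].

(* Residues of the cells c_1, c_2, c_3 (in columns j1, j1 + 1, j1 + 2) when the
   row has length L: no residue is [::], both residues is [:: a; b]. *)
Definition residue_triple (a b L j1 : nat) : seq (seq nat) :=
  if (L.+1 == j1)%N then [:: [:: a; b]; [:: b]; [::]]
  else if (L == j1)%N then [:: [:: a]; [:: b]; [:: b]]
  else if (L == j1.+1)%N then [:: [:: b]; [:: b]; [:: a]]
  else if (L == j1.+2)%N then [:: [::]; [:: b]; [:: a; b]]
  else [:: [::]; [::]; [::]].

Definition upper_residues (n m a b : nat) (len : nat -> nat) (c : cell)
    : seq nat :=
  let t := band_pos n m c in
  nth [::] (residue_triple a b (len c.1) (c.2 - t)) t.

Definition band_residues (n m a b : nat) (la : seq nat) (c : cell) : seq nat :=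
  if (c.1 < c.2)%N then upper_residues n m a b (row_len la) c
  else upper_residues n m a b (col_len la) (c.2, c.1).

Definition main_descalator (c : cell) : bool := `|diag c| <= 1.

Definition main_residue (c : cell) : nat :=
  if (c.1 == c.2)%N then 0%N
  else if ((c.1 + c.2) %% 4 == 1)%N then 1%N else 0%N.

(* All the residues of c with respect to la; [::] if undefined. *)
Definition residues (ty : quotient_type) (n : nat) (la : seq nat) (c : cell)
    : seq nat :=
  if uses_snD ty && in_band n n c then band_residues n n n.-1 n la c
  else if uses_s0D ty && in_band n 0 c then
    if main_descalator c then [:: main_residue c]
    else band_residues n 0 1 0 la c
  else [:: fixed_residue n c].

Definition adjacent (c c' : cell) : bool :=
  (c.1 == c'.1) && ((c.2 == c'.2.+1) || (c'.2 == c.2.+1)) ||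
  (c.2 == c'.2) && ((c.1 == c'.1.+1) || (c'.1 == c.1.+1)).

Inductive connected (D : pred cell) : cell -> cell -> Prop :=
| connected_refl c : D c -> connected D c c
| connected_step c c' c'' :
    D c -> adjacent c c' -> connected D c' c'' -> connected D c c''.

Lemma band_posP (n m : nat) (c : cell) : (2 <= n)%N ->
  in_band n m c <->
  [/\ (0 < c.1)%N, (0 < c.2)%N
    & exists k : int, `|diag c - (m%:Z + k * (2 * n)%:Z)| <= 1].
Proof.
move=> n2; rewrite /in_band /band_pos.
have n0 : (2 * n)%:Z != 0 by lia.
have lt0 := modz_ge0 (diag c - m%:Z + 1) n0.
have := divz_eq (diag c - m%:Z + 1) (2 * n)%:Z.
set q := (_ %/ _)%Z; set p := (_ %% _)%Z in lt0 * => E.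
have ltp : p < (2 * n)%:Z by apply: ltz_pmod; lia.
split.
- by case/and3P=> h1 h2 h3; split=> //; exists q; lia.
- case=> -> -> [k hk] /=.
  have hkq : k = q by nia.
  by rewrite hkq in hk; lia.
Qed.

Lemma band_componentP (n m : nat) (c c' : cell) : (2 <= n)%N ->
  in_band n m c -> in_band n m c' ->
  connected (in_band n m) c c' <->
  exists k : int, `|diag c - (m%:Z + k * (2 * n)%:Z)| <= 1 /\
                  `|diag c' - (m%:Z + k * (2 * n)%:Z)| <= 1.
Proof.
move=> n2 hc hc'; split.
- move=> H; elim: H hc'=> {c c' hc} [c hc _|c c1 c2 hc hadj H IH h2].
    by case/band_posP: hc=> // _ _ [k hk]; exists k.
  have /IH [k [hk1 hk2]] := h2.
  exists k; split=> //.
  case/band_posP: hc=> // _ _ [k' hk'].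
  suff -> : k = k' by [].
  by move: hadj hk1 hk'; rewrite /adjacent /diag; nia.
- case=> k [].
  have inb (d : cell) : (0 < d.1)%N -> (0 < d.2)%N ->
      `|diag d - (m%:Z + k * (2 * n)%:Z)| <= 1 -> in_band n m d.
    by move=> h1 h2 h3; apply/band_posP=> //; split=> //; exists k.
  case/band_posP: hc=> // hc1 hc2 _; case/band_posP: hc'=> // hc1' hc2' _.
  move: (m%:Z + _) inb => t inb.
  have [M] := ubnP (`|c.1%:Z - c'.1%:Z| + `|c.2%:Z - c'.2%:Z|)%N.
  elim: M c hc1 hc2=> // M IH [i j] /= hi hj hM hd hd'.
  case: c' hc1' hc2' hM hd hd' IH => i' j' /= hi' hj' hM hd hd' IH.
  have step (d : cell) : (0 < d.1)%N -> (0 < d.2)%N -> adjacent (i, j) d ->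
      (`|d.1%:Z - i'%:Z| + `|d.2%:Z - j'%:Z| < M)%N ->
      `|diag d - t| <= 1 -> connected (in_band n m) (i, j) (i', j').
    move=> h1 h2 h3 h4 h5; apply: (connected_step _ h3); first exact: inb.
    exact: IH.
  rewrite /diag /= in hd hd' step inb.
  have [ii'|ii'|ii'] := ltngtP i i'.
  + have [jt|jt] := boolP ((j < j')%N && (j%:Z - i%:Z <= t)).
      by apply: (step (i, j.+1)); rewrite /adjacent /=; lia.
    by apply: (step (i.+1, j)); rewrite /adjacent /=; lia.
  + have [jt|jt] := boolP ((j' < j)%N && (t <= j%:Z - i%:Z)).
      by apply: (step (i, j.-1)); rewrite /adjacent /=; lia.
    by apply: (step (i.-1, j)); rewrite /adjacent /=; lia.
  + have [jj'|jj'|jj'] := ltngtP j j'.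
    * by apply: (step (i, j.+1)); rewrite /adjacent /=; lia.
    * by apply: (step (i, j.-1)); rewrite /adjacent /=; lia.
    * by subst i' j'; apply: connected_refl; apply: inb.
Qed.

(** * Central peeling *)

Definition reference_diag (ty : quotient_type) : nat :=
  if uses_s0D ty then 1%N else 0%N.

Definition ref_count (ty : quotient_type) (la : seq nat) : nat :=
  count (fun i => (i + reference_diag ty <= row_len la i)%N) (iota 1 (size la)).

Definition peeling_residue (ty : quotient_type) (n : nat) (la : seq nat)
    (B : cell) (r : nat) : Prop :=
  r \in residues ty n la B /\
  (n \in residues ty n la B -> n.-1 \in residues ty n la B -> r = n).

(* The boxes of row d lost when passing from la to mu. *)
Definition removed_boxes (d : nat) (la mu : seq nat) : seq cell :=
  [seq (d, j) | j <- iota (row_len mu d).+1 (row_len la d - row_len mu d)].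

(* The box recorded in the upper diagram when s_r takes la to mu. *)
Definition recorded (ty : quotient_type) (n d r : nat) (la mu : seq nat)
    : seq cell :=
  if uses_snD ty && (r == n) then
    [seq b <- removed_boxes d la mu | diag b != n%:Z]
  else if uses_s0D ty && (r == 0)%N then
    [seq b <- removed_boxes d la mu | (diag b != 0) && (diag b != (2 * n)%:Z)]
  else [:: (d, row_len la d)].

(* central_peeling ty la rs U: the procedure started at la terminates, with
   word rs = R(la) and recorded boxes U. *)
Inductive central_peeling (ty : quotient_type) (n : nat)
    : seq nat -> seq 'I_n.+1 -> seq cell -> Prop :=
| peeling_done : central_peeling ty [::] [::] [::]
| peeling_step (la mu : seq nat) (d : nat) (r : 'I_n.+1) (rs : seq 'I_n.+1)
    (U : seq cell) :
    la <> [::] ->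
    d = ref_count ty la -> (0 < d)%N ->
    peeling_residue ty n la (d, row_len la d) r ->
    core_act ty r la mu ->
    central_peeling ty mu rs U ->
    central_peeling ty la (r :: rs) (recorded ty n d r la mu ++ U).

(* Main.v *)
Require Import Defs.
From mathcomp Require Import all_boot all_order all_algebra.
From mathcomp Require Import zify.

Set Implicit Arguments.
Unset Strict Implicit.
Unset Printing Implicit Defensive.

Import Order.TTheory GRing.Theory Num.Theory.
Local Open Scope ring_scope.

(** The coset of w is encoded by the levels c_1, ..., c_n of the lowest beads on
    the runners 1, ..., n of its abacus. The generators act on c by affine
    reflections: s_i swaps c_i and c_(i+1), s_0^C is c_1 -> 1 - c_1, s_n^C is
    c_n -> - c_n, and s_0^D, s_n^D send (c_1, c_2) to (1 - c_2, 1 - c_1) and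
    (c_(n-1), c_n) to (- c_n, - c_(n-1)). Counting the reflections that lower the
    coset gives a statistic on c, a sum over pairs of runners, which vanishes at
    c = 0 and changes by at most 1 under a generator, so it bounds from below the
    length of every element of the coset. Central peeling moves the first bead
    right of the reference diagonal to the left, and each of its steps lowers the
    statistic by exactly 1; hence its word is a shortest element of the coset.
    A generator that raises the statistic preserves the property that w is sorted
    on 1, ..., 2n (up to the middle two values in type D), so all words as short
    as the statistic are sorted, and a sorted element is determined by c and by
    the parity condition: this identifies the peeling word with w. Each step
    records one box, and the recorded boxes decrease lexicographically. *)

(** * Quasi-periodic odd maps and the generators *)

Definition quasi (n : nat) (w : int -> int) : Prop :=
  (forall i, w (i + (period n)%:Z) = w i + (period n)%:Z) /\
  (forall i, w (- i) = - w i).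

Lemma quasi_shift n w (k i : int) : quasi n w ->
  w (i + k * (period n)%:Z) = w i + k * (period n)%:Z.
Proof.
case=> h _.
have hn (m : nat) j : w (j + m%:Z * (period n)%:Z) = w j + m%:Z * (period n)%:Z.
  elim: m => [|m IH]; first by rewrite !mul0r !addr0.
  have -> : j + m.+1%:Z * (period n)%:Z
          = (j + m%:Z * (period n)%:Z) + (period n)%:Z by lia.
  by rewrite h IH; lia.
have [k0|k0] := leP 0 k.
  by have -> : k = `|k|%N%:Z by lia.
have := hn `|k|%N (i + k * (period n)%:Z).
have -> : `|k|%N%:Z = - k by lia.
have -> : i + k * (period n)%:Z + - k * (period n)%:Z = i by lia.
lia.
Qed.

Lemma quasi0 n w : quasi n w -> w 0 = 0.
Proof. by case=> _ h; have := h 0; rewrite oppr0; move: (w 0) => a; lia. Qed.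

Lemma quasi_multiple n w (q : int) : quasi n w ->
  w (q * (period n)%:Z) = q * (period n)%:Z.
Proof. by move=> h; have := quasi_shift q 0 h; rewrite !add0r (quasi0 h) add0r. Qed.

Lemma quasi_mirror n w (k i : int) : quasi n w ->
  w (k * (period n)%:Z - i) = k * (period n)%:Z - w i.
Proof.
move=> h; rewrite addrC (quasi_shift _ _ h).
by case: h => _ ->; rewrite addrC.
Qed.

Lemma signed_rep (n : nat) (x : int) : exists q : int,
  x = q * (period n)%:Z \/
  exists2 r : nat, (0 < r <= n)%N &
    x = r%:Z + q * (period n)%:Z \/ x = q * (period n)%:Z - r%:Z.
Proof.
have N0 : (period n)%:Z != 0 by [].
have h0 := modz_ge0 x N0.
have h1 : (x %% (period n)%:Z)%Z < (period n)%:Z by apply: ltz_pmod.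
have E := divz_eq x (period n)%:Z.
move: (x %/ _)%Z (x %% _)%Z h0 h1 E => q s h0 h1 E.
have [s0|s0] := eqVneq s 0; first by exists q; left; lia.
have [sn|sn] := leP s n%:Z.
  by exists q; right; exists `|s|%N; [lia | left; lia].
exists (q + 1); right; exists `|(period n)%:Z - s|%N.
  by move: h1 sn s0 h0; rewrite /period; lia.
by right; lia.
Qed.

Lemma quasi_ext n u v : quasi n u -> quasi n v ->
  (forall k : nat, (0 < k <= n)%N -> u k%:Z = v k%:Z) -> u =1 v.
Proof.
move=> hu hv h x; have [q [->|[r hr [->|->]]]] := signed_rep n x.
- have -> : q * (period n)%:Z = 0 + q * (period n)%:Z by rewrite add0r.
  by rewrite !(quasi_shift _ _ hu) !(quasi_shift _ _ hv) (quasi0 hu) (quasi0 hv).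
- by rewrite (quasi_shift _ _ hu) (quasi_shift _ _ hv) h.
- by rewrite (quasi_mirror _ _ hu) (quasi_mirror _ _ hv) h.
Qed.

Lemma quasi_comp n u v : quasi n u -> quasi n v -> quasi n (u \o v).
Proof.
by case=> u1 u2 [v1 v2]; split=> i /=; rewrite ?v1 ?u1 ?v2 ?u2.
Qed.

Lemma quasi_id n : quasi n id.
Proof. by []. Qed.

Lemma quasi_involutive n w : quasi n w ->
  (forall k : nat, (0 < k <= n)%N -> w (w k%:Z) = k%:Z) -> involutive w.
Proof.
by move=> h hk; apply: (quasi_ext (quasi_comp h h) (quasi_id n)) => k /hk.
Qed.

Lemma small_multiple (a k m : int) : a = k * m -> - m < a < m -> k = 0.
Proof.
move=> -> h; have [k1|k1|//] := ltgtP k 0.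
  have : (- k - 1) * m >= 0 by apply: mulr_ge0; lia.
  lia.
have : (k - 1) * m >= 0 by apply: mulr_ge0; lia.
lia.
Qed.

Lemma divz_period (n : nat) (q r : int) : 0 <= r < (period n)%:Z ->
  ((q * (period n)%:Z + r) %/ (period n)%:Z)%Z = q /\
  ((q * (period n)%:Z + r) %% (period n)%:Z)%Z = r.
Proof.
move=> hr; split; last by rewrite modzMDl modz_small.
by rewrite divzMDl // divz_small ?addr0 // ger0_norm.
Qed.

Lemma mirror_extend_rep (n : nat) f (q : int) (r : nat) : (r < period n)%N ->
  mirror_extend n f (q * (period n)%:Z + r%:Z) = q * (period n)%:Z +
    (if (r == 0)%N then 0 else if (r <= n)%N then f r
     else (period n)%:Z - f (period n - r)%N).
Proof.
move=> hr; rewrite /mirror_extend.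
by have [-> ->] := @divz_period n q r%:Z ltac:(lia).
Qed.

Lemma mirror_extend_small n f (k : nat) : (0 < k <= n)%N ->
  mirror_extend n f k%:Z = f k.
Proof.
move=> hk; have := @mirror_extend_rep n f 0 k ltac:(rewrite /period; lia).
by rewrite !mul0r !add0r => ->; case: k hk => // k /= ->.
Qed.

Lemma mirror_extend_quasi n f : quasi n (mirror_extend n f).
Proof.
have rep (x : int) : exists q (r : nat), (r < period n)%N /\
    x = q * (period n)%:Z + r%:Z.
  have N0 : (period n)%:Z != 0 by [].
  have h0 := modz_ge0 x N0.
  have h1 : (x %% (period n)%:Z)%Z < (period n)%:Z by apply: ltz_pmod.
  exists (x %/ (period n)%:Z)%Z, `|(x %% (period n)%:Z)%Z|%N; split; first lia.
  by rewrite gez0_abs // -divz_eq.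
split=> x; have [q [r [hr ->]]] := rep x.
  have -> : q * (period n)%:Z + r%:Z + (period n)%:Z
          = (q + 1) * (period n)%:Z + r%:Z by lia.
  by rewrite !mirror_extend_rep //; lia.
have [r0|r0] := eqVneq r 0%N.
  have -> : - (q * (period n)%:Z + r%:Z) = (- q) * (period n)%:Z + 0%N%:Z by lia.
  by rewrite !mirror_extend_rep // r0 /=; lia.
have -> : - (q * (period n)%:Z + r%:Z)
        = (- q - 1) * (period n)%:Z + (period n - r)%N%:Z by lia.
rewrite !mirror_extend_rep //; last by lia.
have -> : (period n - (period n - r))%N = r by lia.
rewrite (negPf r0); have -> : (period n - r == 0)%N = false by lia.
have [rn|rn] := leqP r n.
  have -> : (period n - r <= n)%N = false by rewrite /period; lia.
  lia.
have -> : (period n - r <= n)%N by rewrite /period; lia.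
lia.
Qed.

Lemma gen_quasi ty n r : quasi n (@gen ty n r).
Proof. exact: mirror_extend_quasi. Qed.

Lemma gen_small ty n (r : 'I_n.+1) (k : nat) : (0 < k <= n)%N ->
  gen ty r k%:Z = gen_image ty n r k.
Proof. exact: mirror_extend_small. Qed.

Lemma gen_neg ty n (r : 'I_n.+1) (k : nat) : (0 < k <= n)%N ->
  gen ty r (- k%:Z) = - gen_image ty n r k.
Proof. by move=> hk; case: (gen_quasi ty r) => _ ->; rewrite gen_small. Qed.

Lemma gen_mirror ty n (r : 'I_n.+1) (k : nat) : (0 < k <= n)%N ->
  gen ty r ((period n)%:Z - k%:Z) = (period n)%:Z - gen_image ty n r k.
Proof.
by move=> hk; have := quasi_mirror 1 k%:Z (gen_quasi ty r); rewrite mul1r gen_small.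
Qed.

Lemma genK ty n (r : 'I_n.+1) : (2 <= n)%N -> involutive (gen ty r).
Proof.
move=> n2; apply: (quasi_involutive (gen_quasi ty r)) => k hk.
rewrite gen_small //.
have hr := ltn_ord r.
have S (j : nat) x : (0 < j <= n)%N -> x = j%:Z -> gen ty r x = gen_image ty n r j.
  by move=> hj ->; rewrite gen_small.
have M (j : nat) x : (0 < j <= n)%N -> x = - j%:Z -> gen ty r x = - gen_image ty n r j.
  by move=> hj ->; rewrite gen_neg.
have T (j : nat) x : (0 < j <= n)%N -> x = (period n)%:Z - j%:Z ->
   gen ty r x = (period n)%:Z - gen_image ty n r j.
  by move=> hj ->; rewrite gen_mirror.
move: S M T; move: (gen ty r) => g; rewrite /gen_image /period => S M T.
have [r0|r0] := eqVneq (r : nat) 0%N.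
  move: S M T; rewrite r0 /=; case: (uses_s0D ty) => S M T.
    have [k1|k1] := eqVneq k 1%N; first by rewrite (M 2%N) //=; lia.
    have [k2|k2] := eqVneq k 2%N; first by rewrite (M 1%N) //=; lia.
    by rewrite (S k) // (negPf k1) (negPf k2).
  have [k1|k1] := eqVneq k 1%N; first by rewrite (M 1%N) //=; lia.
  by rewrite (S k) // (negPf k1).
have [rn|rn] := eqVneq (r : nat) n.
  move: S M T; rewrite rn eqxx; have -> /= : (n == 0)%N = false by lia.
  case: (uses_snD ty) => S M T.
    have [k1|k1] := eqVneq k n.-1.
      rewrite (T n) //= ?eqxx; [|lia|lia]; have -> : (n == n.-1) = false by lia.
      lia.
    have [k2|k2] := eqVneq k n.
      by rewrite (T n.-1) //= ?eqxx; lia.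
    by rewrite (S k) // (negPf k1) (negPf k2).
  have [k1|k1] := eqVneq k n; first by rewrite (T n) //= ?eqxx; lia.
  by rewrite (S k) // (negPf k1).
move: S M T; rewrite (negPf r0) (negPf rn) => S M T.
have [k1|k1] := eqVneq k r.
  rewrite (S r.+1) //= ?eqxx; last lia; have -> : (r.+1 == r) = false by lia.
  lia.
have [k2|k2] := eqVneq k r.+1; first by rewrite (S r) //= ?eqxx; lia.
by rewrite (S k) // (negPf k1) (negPf k2).
Qed.

(** * Levels of the lowest beads *)

(* c i is the level of the lowest bead on runner i, for 1 <= i <= n; on runner
   2n + 1 - i it is - c i. *)
Definition levels (n : nat) (w : int -> int) (c : nat -> int) : Prop :=
  forall i : nat, (0 < i <= n)%N ->
  exists2 j : nat, (0 < j <= 2 * n)%N & w j%:Z = i%:Z + c i * (period n)%:Z.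

Definition act (ty : quotient_type) (n r : nat) (c : nat -> int) (i : nat) : int :=
  if (r == 0)%N then
    if uses_s0D ty then
      if (i == 1)%N then 1 - c 2%N else if (i == 2)%N then 1 - c 1%N else c i
    else if (i == 1)%N then 1 - c 1%N else c i
  else if (r == n)%N then
    if uses_snD ty then
      if (i == n.-1)%N then - c n else if (i == n)%N then - c n.-1 else c i
    else if (i == n)%N then - c n else c i
  else if (i == r)%N then c r.+1 else if (i == r.+1)%N then c r else c i.

Lemma levels_mirror n w c (i : nat) : quasi n w -> levels n w c ->
  (0 < i <= n)%N -> exists2 j : nat, (0 < j <= 2 * n)%N &
    w j%:Z = (period n)%:Z - i%:Z - c i * (period n)%:Z.
Proof.
move=> hw hc /hc [j hj wj]; exists (period n - j)%N; first by rewrite /period; lia.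
have -> : (period n - j)%N%:Z = 1 * (period n)%:Z - j%:Z by rewrite /period; lia.
by rewrite (quasi_mirror _ _ hw) wj; lia.
Qed.

Lemma mirrored_quasi n w : mirrored n w -> quasi n w.
Proof. by case. Qed.

Lemma inv_quasi n w g : quasi n w -> cancel w g -> cancel g w -> quasi n g.
Proof.
move=> [h1 h2] wg gw; split=> i; apply: (can_inj wg).
  by rewrite h1 !gw.
by rewrite h2 !gw.
Qed.

Lemma levels_inv n w g : quasi n w -> cancel w g -> cancel g w ->
  levels n w (fun i => - (g i%:Z %/ (period n)%:Z)%Z).
Proof.
move=> hw wg gw i hi.
have N0 : (period n)%:Z != 0 by [].
have h0 := modz_ge0 (g i%:Z) N0.
have h1 : (g i%:Z %% (period n)%:Z)%Z < (period n)%:Z by apply: ltz_pmod.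
have E := divz_eq (g i%:Z) (period n)%:Z.
move: (_ %/ _)%Z (_ %% _)%Z h0 h1 E => q s h0 h1 E.
have s0 : s != 0.
  apply/eqP=> s0; have := gw i%:Z; rewrite E s0 addr0 -[q * _]add0r.
  rewrite (quasi_shift _ _ hw) (quasi0 hw) add0r => e.
  have q0 : q = 0 by move: hi e; rewrite /period; nia.
  by move: hi e; rewrite q0; lia.
exists `|s|%N; first by move: h1; rewrite /period; lia.
have -> : `|s|%N%:Z = g i%:Z + (- q) * (period n)%:Z by lia.
by rewrite (quasi_shift _ _ hw) gw.
Qed.

Lemma levels_uniq n w c c' : quasi n w -> injective w ->
  levels n w c -> levels n w c' -> forall i : nat, (0 < i <= n)%N -> c i = c' i.
Proof.
move=> hw wi hc hc' i hi.
have [j hj wj] := hc i hi; have [k hk wk] := hc' i hi.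
have e : w (j%:Z + (c' i - c i) * (period n)%:Z) = w k%:Z.
  by rewrite (quasi_shift _ _ hw) wj wk; lia.
move/wi: e; rewrite /period; nia.
Qed.

Lemma eq_levels n w w' c : levels n w c -> w =1 w' -> levels n w' c.
Proof. by move=> h e i /h [j hj wj]; exists j; rewrite // -e. Qed.

Lemma levels_id n : levels n id (fun _ => 0).
Proof. by move=> i hi; exists i; lia. Qed.

Lemma gen_preim ty n (r : 'I_n.+1) u (j x : int) :
  (2 <= n)%N -> u j = gen ty r x -> (gen ty r \o u) j = x.
Proof. by move=> n2 h; rewrite /= h genK. Qed.

Lemma levels_gen ty n (r : 'I_n.+1) u c : (2 <= n)%N -> quasi n u ->
  levels n u c -> levels n (gen ty r \o u) (act ty n r c).
Proof.
move=> n2 hu hc i hi.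
have hr := ltn_ord r.
suff [j hj wj] : exists2 j : nat, (0 < j <= 2 * n)%N &
    u j%:Z = gen_image ty n r i + act ty n r c i * (period n)%:Z.
  exists j => //; apply: gen_preim => //.
  by rewrite (quasi_shift _ _ (gen_quasi ty r)) gen_small.
have hm := levels_mirror hu hc.
have B (k : nat) (x : int) : (0 < k <= n)%N -> x = k%:Z + c k * (period n)%:Z ->
    exists2 j : nat, (0 < j <= 2 * n)%N & u j%:Z = x.
  by move=> hk ->; apply: hc.
have M (k : nat) (x : int) : (0 < k <= n)%N ->
    x = (period n)%:Z - k%:Z - c k * (period n)%:Z ->
    exists2 j : nat, (0 < j <= 2 * n)%N & u j%:Z = x.
  by move=> hk ->; apply: hm.
rewrite /gen_image /act.
have [r0|r0] := eqVneq (r : nat) 0%N.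
  case: (uses_s0D ty).
    have [i1|i1] := eqVneq i 1%N; first by apply: (M 2%N); lia.
    have [i2|i2] := eqVneq i 2%N; first by apply: (M 1%N); lia.
    by apply: (B i).
  have [i1|i1] := eqVneq i 1%N; first by apply: (M 1%N); lia.
  by apply: (B i).
have [rn|rn] := eqVneq (r : nat) n.
  case: (uses_snD ty).
    have [i1|i1] := eqVneq i n.-1; first by apply: (M n); rewrite /period; lia.
    have [i2|i2] := eqVneq i n; first by apply: (M n.-1); rewrite /period; lia.
    by apply: (B i).
  have [i1|i1] := eqVneq i n; first by apply: (M n); rewrite /period; lia.
  by apply: (B i).
have [i1|i1] := eqVneq i r; first by apply: (B r.+1); lia.
have [i2|i2] := eqVneq i r.+1; first by apply: (B r); lia.
by apply: (B i).
Qed.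

Definition window_perm (n : nat) (x : int -> int) : Prop :=
  forall j : nat, (0 < j <= 2 * n)%N ->
  exists2 k : nat, (0 < k <= 2 * n)%N & x k%:Z = j%:Z.

Lemma levels_right n w x c : levels n w c -> window_perm n x ->
  levels n (w \o x) c.
Proof.
move=> hc hx i /hc [j hj wj]; have [k hk xk] := hx j hj.
by exists k => //=; rewrite xk.
Qed.

Lemma window_perm_comp n x y : window_perm n x -> window_perm n y ->
  window_perm n (x \o y).
Proof.
move=> hx hy j /hx [k hk xk]; have [l hl yl] := hy k hk.
by exists l => //=; rewrite yl.
Qed.

Lemma gen_window ty n (r : 'I_n.+1) : (2 <= n)%N -> (0 < r)%N ->
  window_perm n (gen ty r).
Proof.
move=> n2 r0.
have hr := ltn_ord r.
have small (i : nat) : (0 < i <= n)%N ->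
    exists2 k : nat, (0 < k <= 2 * n)%N & gen ty r i%:Z = k%:Z.
  move=> hi; rewrite gen_small // /gen_image.
  have -> : (r : nat) == 0%N = false by lia.
  have [rn|rn] := eqVneq (r : nat) n.
    case: (uses_snD ty).
      have [i1|i1] := eqVneq i n.-1; first by exists n.+1; lia.
      have [i2|i2] := eqVneq i n; first by exists n.+2; lia.
      by exists i; lia.
    have [i1|i1] := eqVneq i n; first by exists n.+1; lia.
    by exists i; lia.
  have [i1|i1] := eqVneq i r; first by exists r.+1; lia.
  have [i2|i2] := eqVneq i r.+1; first by exists (r : nat); lia.
  by exists i; lia.
have all (i : nat) : (0 < i <= 2 * n)%N ->
    exists2 k : nat, (0 < k <= 2 * n)%N & gen ty r i%:Z = k%:Z.
  move=> hi; have [hin|hin] := leqP i n; first by apply: small; lia.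
  have [k hk e] := small (period n - i)%N ltac:(rewrite /period; lia).
  exists (period n - k)%N; first by rewrite /period; lia.
  have -> : i%:Z = 1 * (period n)%:Z - (period n - i)%N%:Z by rewrite /period; lia.
  by rewrite (quasi_mirror _ _ (gen_quasi ty r)) e; rewrite /period; lia.
move=> j /all [k hk e]; exists k => //.
by rewrite -e genK.
Qed.

(** * The core as a function of the levels *)

Lemma path_rows_cat c s1 s2 : path_rows c (s1 ++ s2) =
  path_rows (c + count negb s1) s2 ++ path_rows c s1.
Proof.
elim: s1 c => [|[] s IH] c /=; first by rewrite addn0 cats0.
  by rewrite IH add0n rcons_cat.
by rewrite IH; congr (path_rows _ _ ++ _); lia.
Qed.

Lemma size_path_rows c s : size (path_rows c s) = count id s.
Proof. by elim: s c => [|[] s IH] c //=; rewrite ?size_rcons IH. Qed.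

Lemma path_rows_ge c s : all (leq c) (path_rows c s).
Proof.
elim: s c => [|[] s IH] c //=; first by rewrite all_rcons leqnn IH.
by apply: sub_all (IH c.+1) => x; lia.
Qed.

Lemma path_rows_le c s : all (geq (c + count negb s)%N) (path_rows c s).
Proof.
elim: s c => [|[] s IH] c //=.
  by rewrite all_rcons add0n IH andbT /= leq_addr.
by rewrite add1n -addSnnS IH.
Qed.

Definition rows_of (s : seq bool) : seq nat :=
  [seq l <- path_rows 0 s | (0 < l)%N].

Lemma row_len_rows_of s1 s2 :
  row_len (rows_of (s1 ++ true :: s2)) (count id s2).+1 = count negb s1.
Proof.
rewrite /row_len /rows_of path_rows_cat /= cat_rcons filter_cat add0n.
set g := count negb s1.
have hA := path_rows_ge g s2; have szA := size_path_rows g s2.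
have hB := path_rows_le 0 s1; rewrite add0n -/g in hB.
have [g0|g0] := posnP g.
  rewrite [X in _ ++ X](_ : _ = [::]) ?cats0 ?nth_default //.
    by rewrite -szA size_filter count_size.
  rewrite /= g0; apply/eqP; rewrite -[_ == _]negbK -has_filter -all_predC.
  by apply: sub_all hB => x /=; lia.
rewrite (_ : [seq l <- path_rows g s2 | 0 < l]%N = path_rows g s2).
  by rewrite -szA nth_cat ltnn subnn /= g0.
by apply/all_filterP; apply: sub_all hA => x /=; lia.
Qed.

Lemma size_rows_of s : (size (rows_of s) <= count id s)%N.
Proof. by rewrite /rows_of size_filter -(size_path_rows 0 s) count_size. Qed.

Lemma path_rows_nseq_true c a s :
  path_rows c (nseq a true ++ s) = path_rows c s ++ nseq a c.
Proof.
rewrite path_rows_cat; congr (path_rows _ _ ++ _).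
  by elim: a => [|a IH] /=; rewrite ?addn0 ?add0n.
by elim: a => //= a ->; elim: a => //= a ->.
Qed.

Lemma path_rows_nseq_false c a : path_rows c (nseq a false) = [::].
Proof. by elim: a c => //=. Qed.

Lemma rows_of_pad a b s : rows_of (nseq a true ++ s ++ nseq b false) = rows_of s.
Proof.
rewrite /rows_of path_rows_nseq_true path_rows_cat path_rows_nseq_false /=.
by rewrite filter_cat [X in _ ++ X](_ : _ = [::]) ?cats0 //; elim: a.
Qed.

Definition pbead (n : nat) (c : nat -> int) (q : int) : bool :=
  let m := (q %/ (2 * n)%:Z)%Z + 1 in let s := `|(q %% (2 * n)%:Z)%Z|%N in
  if (s < n)%N then m <= c s.+1 else m <= - c (2 * n - s)%N.

Lemma pbead_rep n c (m : int) (s : nat) : (s < 2 * n)%N ->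
  pbead n c (m * (2 * n)%:Z + s%:Z) =
  if (s < n)%N then m + 1 <= c s.+1 else m + 1 <= - c (2 * n - s)%N.
Proof.
move=> hs; rewrite /pbead.
have -> : ((m * (2 * n)%:Z + s%:Z) %/ (2 * n)%:Z)%Z = m.
  by rewrite divzMDl ?divz_small ?addr0 //; lia.
by have -> : ((m * (2 * n)%:Z + s%:Z) %% (2 * n)%:Z)%Z = s%:Z by rewrite modzMDl modz_small; lia.
Qed.

Lemma pos_rep (n : nat) (q : int) : (0 < n)%N ->
  exists (m : int) (s : nat), (s < 2 * n)%N /\ q = m * (2 * n)%:Z + s%:Z.
Proof.
move=> n0; have N0 : (2 * n)%:Z != 0 by lia.
have h0 := modz_ge0 q N0.
have h1 : (q %% (2 * n)%:Z)%Z < (2 * n)%:Z by apply: ltz_pmod; lia.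
exists (q %/ (2 * n)%:Z)%Z, `|(q %% (2 * n)%:Z)%Z|%N; split; first lia.
by rewrite gez0_abs // -divz_eq.
Qed.

Lemma pbead_opp n c q : (0 < n)%N -> pbead n c (- 1 - q) = ~~ pbead n c q.
Proof.
move=> n0; have [m [s [hs ->]]] := pos_rep q n0.
have -> : - 1 - (m * (2 * n)%:Z + s%:Z) =
  (- m - 1) * (2 * n)%:Z + (2 * n - s.+1)%N%:Z by lia.
rewrite !pbead_rep //; last by lia.
have [sn|sn] := ltnP s n.
  have -> : (2 * n - s.+1 < n)%N = false by lia.
  have -> : (2 * n - (2 * n - s.+1))%N = s.+1 by lia.
  lia.
have -> : (2 * n - s.+1 < n)%N by lia.
have -> : (2 * n - s.+1).+1 = (2 * n - s)%N by lia.
lia.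
Qed.

(* The label of the entry in position q of the reading order, position 0 being
   the entry N + 1 right of the center; the last box of a row ending at the
   bead in position q lies on the q-th diagonal. *)
Definition label (n : nat) (q : int) : int :=
  ((q %/ (2 * n)%:Z)%Z + 1) * (period n)%:Z + (q %% (2 * n)%:Z)%Z + 1.

Lemma label_rep n (m : int) (s : nat) : (s < 2 * n)%N ->
  label n (m * (2 * n)%:Z + s%:Z) = (m + 1) * (period n)%:Z + s.+1%:Z.
Proof.
move=> hs; rewrite /label.
have -> : ((m * (2 * n)%:Z + s%:Z) %/ (2 * n)%:Z)%Z = m.
  by rewrite divzMDl ?divz_small ?addr0 //; lia.
have -> : ((m * (2 * n)%:Z + s%:Z) %% (2 * n)%:Z)%Z = s%:Z by rewrite modzMDl modz_small; lia.
lia.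
Qed.

Lemma entry_rep n (m : int) (s : nat) : (s < period n)%N ->
  entry n (m * (period n)%:Z + s%:Z) = (s != 0)%N.
Proof.
move=> hs; rewrite /entry; congr (~~ _).
apply/dvdzP/eqP => [[k hk]|->]; last by exists m; lia.
have k0 : k - m = 0.
  by apply: (@small_multiple s%:Z _ (period n)%:Z); [rewrite mulrBl -hk | ]; lia.
by have e : k = m by [lia]; rewrite e in hk; lia.
Qed.

Lemma bead_lowest n w (x y : int) (j : nat) (k : int) : quasi n w -> injective w ->
  (0 < j <= 2 * n)%N -> w j%:Z = y -> x = y + k * (period n)%:Z ->
  entry n x -> bead n w x = (k <= 0).
Proof.
move=> hw wi hj wj xy ex; rewrite /bead ex /=.
apply/hasP/idP => [[i]|k0].
  rewrite mem_iota => hi /andP[]; rewrite eqz_mod_dvd => /dvdzP [l hl] le.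
  have e : w i%:Z = w (j%:Z + (l + k) * (period n)%:Z).
    by rewrite (quasi_shift _ _ hw) wj; lia.
  move/wi: e => e; have lk : l + k = 0.
    apply: (@small_multiple (i%:Z - j%:Z) _ (period n)%:Z); first by lia.
    by rewrite /period; lia.
  have e' : i = j by rewrite lk in e; lia.
  subst i; move: le; rewrite wj xy => le.
  have [//|k1] := leP k 0.
  have : (k - 1) * (period n)%:Z >= 0 by apply: mulr_ge0; lia.
  by move: le; rewrite /period; lia.
exists j; first by rewrite mem_iota; lia.
apply/andP; split; last first.
  by rewrite wj xy; have : - k * (period n)%:Z >= 0 by [apply: mulr_ge0; lia]; lia.
by rewrite eqz_mod_dvd; apply/dvdzP; exists (- k); rewrite wj xy; lia.
Qed.

Lemma bead_label n w c q : (0 < n)%N -> quasi n w -> injective w -> levels n w c ->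
  bead n w (label n q) = pbead n c q.
Proof.
move=> n0 hw wi hc; have [m [s [hs ->]]] := pos_rep q n0.
rewrite label_rep // pbead_rep //.
have e : entry n ((m + 1) * (period n)%:Z + s.+1%:Z).
  by rewrite entry_rep // /period; lia.
case: ltnP => sn.
  have [j hj wj] := hc s.+1 ltac:(lia).
  by rewrite (bead_lowest (k := m + 1 - c s.+1) hw wi hj wj) //; lia.
have [j hj wj] := levels_mirror (i := (2 * n - s)%N) hw hc ltac:(lia).
rewrite (bead_lowest (k := m + 1 + c (2 * n - s)%N) hw wi hj wj) //; first by lia.
by rewrite /period; lia.
Qed.

Definition psteps (n : nat) (c : nat -> int) (K : nat) : seq bool :=
  [seq pbead n c (t%:Z - K%:Z) | t <- iota 0 (2 * K)].

Lemma entries_block n (a : int) (m : nat) : (0 < n)%N ->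
  [seq x <- [seq t%:Z + a * (period n)%:Z | t <- iota 0 (m * period n)] | entry n x] =
  [seq label n (t%:Z + (a - 1) * (2 * n)%:Z) | t <- iota 0 (m * (2 * n))].
Proof.
move=> n0; elim: m => [|m IH] //.
rewrite !(mulSnr m) (iotaD _ (m * period n)) (iotaD _ (m * (2 * n))) !map_cat filter_cat IH.
rewrite !add0n; congr (_ ++ _).
have -> : iota (m * period n) (period n) =
  (m * period n)%N :: [seq ((m * period n).+1 + t)%N | t <- iota 0 (2 * n)].
  by rewrite -iotaDl addn0.
rewrite -[(m * (2 * n))%N in RHS]addn0 iotaDl [map _ (_ :: _)]map_cons -!map_comp.
have -> : (m * period n)%N%:Z + a * (period n)%:Z =
  (m%:Z + a) * (period n)%:Z + 0%N%:Z by lia.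
rewrite [filter _ (_ :: _)]/= entry_rep //=.
rewrite (eq_in_map _ (fun t : nat => (m%:Z + a) * (period n)%:Z + t.+1%:Z) _).1; last first.
  by move=> t _; rewrite /comp; lia.
rewrite (all_filterP _).
  apply/eq_in_map => t; rewrite mem_iota => ht /=.
  have -> : ((m * (2 * n) + t)%N%:Z + (a - 1) * (2 * n)%:Z) =
    (m%:Z + a - 1) * (2 * n)%:Z + t%:Z by lia.
  by rewrite label_rep; lia.
apply/allP => x /mapP [t]; rewrite mem_iota => ht ->.
by rewrite entry_rep // /period; lia.
Qed.

Lemma core_levels n w c : (0 < n)%N -> mirrored n w -> levels n w c ->
  exists k0 : nat, (forall i : nat, (0 < i <= n)%N -> (`|c i| <= k0)%N) /\
  forall k : nat, (k0 <= k)%N -> core n w = rows_of (psteps n c (k * (2 * n))).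
Proof.
move=> n0 mw hc; have hw := mirrored_quasi mw.
have wi : injective w by case: mw => /bij_inj.
pose M := window n w.
have hM (j : nat) : (0 < j <= 2 * n)%N -> (`|w j%:Z| <= M)%N.
  move=> hj; rewrite /M /window; apply: (@leq_bigmax_seq _ _ _ (fun j : nat => `|w j%:Z|%N)) => //.
  by rewrite mem_index_iota; lia.
exists M.+1; split.
  move=> i hi; have [j hj wj] := hc i hi; have := hM j hj.
  by rewrite wj /period; nia.
move=> k hk.
have hA : (M <= k.-1 * period n)%N by rewrite /period; nia.
pose A := (k.-1 * period n - M)%N.
pose B := (k.+1 * period n - M.+1)%N.
have hB : (M < k.+1 * period n)%N by rewrite /period; nia.
pose a : int := 1 - k%:Z.
have eL : (2 * k * period n)%N = (A + ((2 * M).+1 + B))%N.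
  by rewrite /A /B; move: hA hB hk; case: (k) => //= k'; lia.
rewrite /psteps.
have -> : (2 * (k * (2 * n)))%N = ((2 * k) * (2 * n))%N by lia.
have -> : [seq pbead n c (t%:Z - (k * (2 * n))%N%:Z) | t <- iota 0 (2 * k * (2 * n))]
  = [seq bead n w x | x <- [seq label n (t%:Z + (a - 1) * (2 * n)%:Z) | t <- iota 0 (2 * k * (2 * n))]].
  rewrite -map_comp; apply: eq_map => t /=; rewrite (bead_label _ n0 hw wi hc).
  by congr (pbead _ _ _); rewrite /a; lia.
rewrite -entries_block // eL !iotaD !map_cat !filter_cat !map_cat add0n.
have front : [seq bead n w x | x <- [seq x <- [seq t%:Z + a * (period n)%:Z | t <- iota 0 A] | entry n x]]
   = nseq (count (entry n) [seq t%:Z + a * (period n)%:Z | t <- iota 0 A]) true.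
  rewrite -size_filter.
  have : all (fun x => x < - M%:Z) [seq x <- [seq t%:Z + a * (period n)%:Z | t <- iota 0 A] | entry n x].
    apply/allP => x; rewrite mem_filter => /andP[_ /mapP [t]].
    rewrite mem_iota add0n => /andP[_ ht] ->; move: ht; rewrite /A /a.
    have : (k.-1 * period n)%N%:Z = (k%:Z - 1) * (period n)%:Z by case: (k) hk => //= k'; lia.
    by lia.
  have : all (entry n) [seq x <- [seq t%:Z + a * (period n)%:Z | t <- iota 0 A] | entry n x].
    exact: filter_all.
  elim: (filter _ _) => //= x s IH /andP[ex es] /andP[lx ls].
  rewrite IH //; congr cons.
  have [q [xq|[r hr xq]]] := signed_rep n x.
    by move: ex; rewrite xq -[_ * _]addr0 (entry_rep q (s := 0%N)).
  case: xq => xq.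
    have [j hj wj] := hc r hr; have := hM j hj.
    rewrite (bead_lowest (k := q - c r) hw wi hj wj) //; last by lia.
    by move: lx; rewrite wj xq /period; nia.
  have [j hj wj] := levels_mirror hw hc hr; have := hM j hj.
  rewrite (bead_lowest (k := q - 1 + c r) hw wi hj wj) //; last by lia.
  by move: lx; rewrite wj xq /period; nia.
have back : [seq bead n w x | x <- [seq x <- [seq t%:Z + a * (period n)%:Z | t <- iota (A + (2 * M).+1) B] | entry n x]]
   = nseq (count (entry n) [seq t%:Z + a * (period n)%:Z | t <- iota (A + (2 * M).+1) B]) false.
  rewrite -size_filter.
  have : all (fun x => M%:Z < x) [seq x <- [seq t%:Z + a * (period n)%:Z | t <- iota (A + (2 * M).+1) B] | entry n x].
    apply/allP => x; rewrite mem_filter => /andP[_ /mapP [t]].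
    rewrite mem_iota => /andP[ht _] ->; move: ht; rewrite /A /a.
    have : (k.-1 * period n)%N%:Z = (k%:Z - 1) * (period n)%:Z by case: (k) hk => //= k'; lia.
    by lia.
  elim: (filter _ _) => //= x s IH /andP[lx ls].
  rewrite IH //; congr cons.
  apply/negbTE/negP => /andP[_ /hasP [j]]; rewrite mem_iota => hj /andP[_].
  by have := hM j ltac:(lia); lia.
rewrite front back rows_of_pad /core /rows_of /reading_order -/M; congr [seq l <- path_rows 0 [seq bead n w x | x <- filter _ _] | _].
rewrite -[in RHS](addn0 A) iotaDl -map_comp; apply: eq_map => t /=.
have : (k.-1 * period n)%N%:Z = (k%:Z - 1) * (period n)%:Z by case: (k) hk => //= k'; lia.
by rewrite /A /a; lia.
Qed.

(** * Row lengths of the core and counts of beads *)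

Definition positions (K : nat) : seq int := [seq t%:Z - K%:Z | t <- iota 0 (2 * K)].

Lemma mem_positions K (q : int) : (q \in positions K) = (- K%:Z <= q < K%:Z).
Proof.
apply/mapP/idP => [[t]|hq]; first by rewrite mem_iota; lia.
by exists `|(q + K%:Z)%R|%N; rewrite ?mem_iota; lia.
Qed.

Lemma positions_uniq K : uniq (positions K).
Proof. by rewrite map_inj_uniq ?iota_uniq // => x y; lia. Qed.

Definition nbeads (n : nat) (c : nat -> int) (K : nat) (q : int) : nat :=
  count [pred x | pbead n c x && (q <= x)] (positions K).

Lemma psteps_positions n c K : psteps n c K = [seq pbead n c x | x <- positions K].
Proof. by rewrite /positions -map_comp. Qed.

Lemma count_pbead n c K : (0 < n)%N -> count (pbead n c) (positions K) = K.
Proof.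
move=> n0.
have e : perm_eq (positions K) [seq - 1 - x | x <- positions K].
  apply: uniq_perm; rewrite ?positions_uniq //.
    by rewrite map_inj_uniq ?positions_uniq // => x y; lia.
  move=> x; rewrite mem_positions; apply/idP/mapP => [h|[y]].
    by exists (- 1 - x); rewrite ?mem_positions; lia.
  by rewrite mem_positions; lia.
have E : count (pbead n c) (positions K) = count (predC (pbead n c)) (positions K).
  apply: etrans (permP e _) _; rewrite count_map.
  by apply: eq_count => x /=; rewrite pbead_opp.
have := count_predC (pbead n c) (positions K).
by rewrite -E size_map size_iota; lia.
Qed.

Lemma positions_split K (q : int) : - K%:Z <= q < K%:Z -> exists s1 s2,
  [/\ positions K = s1 ++ q :: s2, size s1 = `|(q + K%:Z)%R|%N,
      all (fun x => x < q) s1 & all (fun x => q < x) s2].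
Proof.
move=> hq; pose k := `|(q + K%:Z)%R|%N.
exists [seq t%:Z - K%:Z | t <- iota 0 k], [seq t%:Z - K%:Z | t <- iota k.+1 (2 * K - k.+1)].
split.
- rewrite /positions [X in iota 0 X](_ : _ = (k + (1 + (2 * K - k.+1)))%N); last first.
    by rewrite /k; lia.
  rewrite iotaD map_cat add0n; congr (_ ++ _).
  rewrite iotaD map_cat addn1 /=; congr (_ :: _).
  by rewrite /k; lia.
- by rewrite size_map size_iota.
- by apply/allP => x /mapP [t]; rewrite mem_iota /k; lia.
- by apply/allP => x /mapP [t]; rewrite mem_iota /k; lia.
Qed.

Lemma row_len_bead n c K q : (0 < n)%N -> - K%:Z <= q < K%:Z -> pbead n c q ->
  (0 < nbeads n c K q)%N /\
  (row_len (rows_of (psteps n c K)) (nbeads n c K q))%:Z = q + (nbeads n c K q)%:Z.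
Proof.
move=> n0 hq bq; have [s1 [s2 [e sz a1 a2]]] := positions_split hq.
have tot := count_pbead c K n0; rewrite e count_cat /= bq in tot.
have nb : nbeads n c K q = (count (pbead n c) s2).+1.
  rewrite /nbeads e count_cat /= bq lexx /=.
  have -> : count [pred x | pbead n c x && (q <= x)] s1 = 0%N.
    apply/eqP; rewrite -leqn0 leqNgt -has_count; apply/hasPn => x hx /=.
    by have := allP a1 x hx; lia.
  have -> : count [pred x | pbead n c x && (q <= x)] s2 = count (pbead n c) s2.
    by apply: eq_in_count => x /(allP a2) /=; lia.
  by rewrite add0n.
rewrite nb psteps_positions e map_cat /= bq; split => //.
have -> : count (pbead n c) s2 = count id [seq pbead n c x | x <- s2].
  by rewrite count_map.
rewrite row_len_rows_of !count_map.
have := count_predC (pbead n c) s1.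
have -> : count (preim (pbead n c) negb) s1 = count (predC (pbead n c)) s1 by [].
have -> : count (preim (pbead n c) id) s2 = count (pbead n c) s2 by [].
lia.
Qed.

Lemma nbeads_le n c K q : (0 < n)%N -> (nbeads n c K q <= K)%N.
Proof.
move=> n0; rewrite -{2}(count_pbead c K n0); apply: sub_count => x /=.
by case/andP.
Qed.

Definition row_ends (la : seq nat) (K : nat) : seq int :=
  [seq (row_len la i)%:Z - i%:Z | i <- iota 1 K].

Lemma perm_row_ends n c K : (0 < n)%N ->
  perm_eq [seq q <- positions K | pbead n c q] (row_ends (rows_of (psteps n c K)) K).
Proof.
move=> n0; set B := filter _ _; set X := row_ends _ _.
have uB : uniq B by rewrite filter_uniq ?positions_uniq.
have sB : size B = K by rewrite size_filter count_pbead.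
have sX : size X = K by rewrite size_map size_iota.
have sub : {subset B <= X}.
  move=> q; rewrite mem_filter mem_positions => /andP[bq hq].
  have [h1 h2] := row_len_bead n0 hq bq; have h3 := nbeads_le c K q n0.
  by apply/mapP; exists (nbeads n c K q); rewrite ?mem_iota; lia.
have [eqs mem] := uniq_min_size uB sub ltac:(by rewrite sX sB).
apply: uniq_perm => //.
by rewrite -(eq_uniq eqs mem).
Qed.

Lemma ref_count_nbeads n ty c K : (0 < n)%N ->
  ref_count ty (rows_of (psteps n c K)) = nbeads n c K (reference_diag ty)%:Z.
Proof.
move=> n0; set la := rows_of _.
have sz : (size la <= K)%N.
  apply: leq_trans (size_rows_of _) _.
  by rewrite psteps_positions count_map (count_pbead c K n0).
have -> : nbeads n c K (reference_diag ty)%:Z =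
    count [pred x | (reference_diag ty)%:Z <= x] (row_ends la K).
  rewrite -(permP (perm_row_ends c K n0)) count_filter.
  by apply: eq_count => x /=; rewrite andbC.
rewrite count_map /ref_count.
rewrite -[in RHS](subnKC sz) iotaD count_cat.
have -> : count (preim (fun i : nat => (row_len la i)%:Z - i%:Z)
       [pred x | (reference_diag ty)%:Z <= x]) (iota (1 + size la) (K - size la)) = 0%N.
  apply/eqP; rewrite -leqn0 leqNgt -has_count; apply/hasPn => i; rewrite mem_iota => hi /=.
  by rewrite /row_len nth_default //; lia.
by rewrite addn0; apply: eq_count => i /=; lia.
Qed.

Lemma rows_of_pbead n c c' K q : (0 < n)%N ->
  rows_of (psteps n c K) = rows_of (psteps n c' K) ->
  - K%:Z <= q < K%:Z -> pbead n c q = pbead n c' q.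
Proof.
move=> n0 e hq.
have h := perm_mem (perm_row_ends c K n0) q; rewrite e -(perm_mem (perm_row_ends c' K n0)) in h.
by move: h; rewrite !mem_filter mem_positions hq !andbT.
Qed.

Lemma pbead_inj n c c' (k : nat) :
  (forall i : nat, (0 < i <= n)%N -> (`|c i| < k)%N) ->
  (forall i : nat, (0 < i <= n)%N -> (`|c' i| < k)%N) ->
  (forall q : int, - (k * (2 * n))%N%:Z <= q < (k * (2 * n))%N%:Z ->
     pbead n c q = pbead n c' q) ->
  forall i : nat, (0 < i <= n)%N -> c i = c' i.
Proof.
move=> hc hc' h i hi.
have H (m : int) : - k%:Z <= m < k%:Z -> (m + 1 <= c i) = (m + 1 <= c' i).
  move=> hm; have := h (m * (2 * n)%:Z + i.-1%:Z) ltac:(nia).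
  rewrite !pbead_rep; try lia.
  by have -> : (i.-1 < n)%N by [lia]; have -> : i.-1.+1 = i by lia.
have := hc i hi; have := hc' i hi.
by have := H (c i - 1); have := H (c' i - 1); lia.
Qed.

Lemma nbeads_eq n c K (p q : int) : p <= q ->
  (forall x, p <= x < q -> ~~ pbead n c x) -> nbeads n c K p = nbeads n c K q.
Proof.
move=> pq h; apply: eq_count => x /=.
case: (boolP (pbead n c x)) => //= bx.
have [qx|qx] := boolP (q <= x); first by lia.
apply/negbTE/negP => px.
by have := h x ltac:(lia); rewrite bx.
Qed.

Lemma nbeads_S n c K (q : int) : - K%:Z <= q < K%:Z ->
  nbeads n c K q = (pbead n c q + nbeads n c K (q + 1))%N.
Proof.
move=> hq; have [s1 [s2 [e sz a1 a2]]] := positions_split hq.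
rewrite /nbeads e !count_cat /= lexx andbT.
have -> : (q + 1 <= q) = false by lia.
rewrite andbF add0n addnCA; congr (_ + (_ + _))%N.
  by apply: eq_in_count => x /(allP a1) /=; lia.
by apply: eq_in_count => x /(allP a2) /=; lia.
Qed.

Lemma count_level n c (k : nat) : (0 < n)%N ->
  count (pbead n c) [seq t%:Z | t <- iota (k * (2 * n)) (2 * n)] =
  (\sum_(1 <= a < n.+1) ((k%:Z < c a)%R + (k%:Z < - c a)%R))%N.
Proof.
move=> n0; rewrite -[(k * (2 * n))%N]addn0 iotaDl -map_comp count_map.
rewrite big_split /= -sum1_count big_mkcond /=.
have -> : iota 0 (2 * n) = index_iota 0 (2 * n) by rewrite /index_iota subn0.
rewrite (big_cat_nat (n := n)) //=; last by lia.
congr (_ + _)%N.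
  rewrite big_add1 /=; apply: eq_big_nat => s hs.
  have -> : (k * (2 * n) + s)%N%:Z = k%:Z * (2 * n)%:Z + s%:Z by lia.
  rewrite pbead_rep; last by lia.
  by have -> : (s < n)%N by [lia]; case: ifP; lia.
rewrite big_add1 /= [RHS]big_nat_rev /= -{1}[n]add0n big_addn.
have -> : (2 * n - n = n)%N by lia.
apply: eq_big_nat => s hs.
have -> : (k * (2 * n) + (s + n))%N%:Z = k%:Z * (2 * n)%:Z + (s + n)%N%:Z by lia.
rewrite pbead_rep; last by lia.
have -> : (s + n < n)%N = false by lia.
have -> : (2 * n - (s + n))%N = (0 + n - s.+1).+1 by lia.
by case: ifP; lia.
Qed.

Lemma nbeads0 n c (k : nat) : (0 < n)%N ->
  (forall i : nat, (0 < i <= n)%N -> (`|c i| <= k)%N) ->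
  nbeads n c (k * (2 * n)) 0 = (\sum_(1 <= a < n.+1) `|c a|)%N.
Proof.
move=> n0 hc.
have -> : nbeads n c (k * (2 * n)) 0 = count (pbead n c) [seq t%:Z | t <- iota 0 (k * (2 * n))].
  set K := (k * (2 * n))%N; rewrite /nbeads /positions.
  have -> : (2 * K = K + K)%N by lia.
  rewrite iotaD map_cat count_cat !count_map add0n.
  have -> : count (preim (fun t : nat => t%:Z - K%:Z) [pred x | pbead n c x && (0 <= x)]) (iota 0 K) = 0%N.
    apply/eqP; rewrite -leqn0 leqNgt -has_count; apply/hasPn => i; rewrite mem_iota => hi /=.
    by lia.
  rewrite add0n -[X in iota X _](addn0 K) iotaDl count_map; apply: eq_count => i /=.
  by have -> : (K + i)%N%:Z - K%:Z = i%:Z by [lia]; rewrite andbT.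
have {hc} : (\sum_(1 <= a < n.+1) `|c a| = \sum_(1 <= a < n.+1) minn k `|c a|)%N.
  by apply: eq_big_nat => a ha; have := hc a ltac:(lia); lia.
move=> ->; elim: k => [|k IH].
  by rewrite /= big1 // => a _; rewrite min0n.
rewrite mulSnr iotaD map_cat count_cat IH add0n count_level // -big_split /=.
by apply: eq_big_nat => a _; lia.
Qed.

(** * The length statistic *)

Lemma sum_pair (n i : nat) (F : nat -> int) : (0 < i < n)%N ->
  \sum_(1 <= a < n.+1) F a = \sum_(1 <= a < i) F a + (F i + F i.+1) +
    \sum_(i.+2 <= a < n.+1) F a.
Proof.
move=> hi; rewrite (big_cat_nat (n := i)) //=; try lia.
rewrite (big_ltn (m := i)); last by lia.
by rewrite (big_ltn (m := i.+1)) ?addrA //; lia.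
Qed.

Lemma eq_sum_pair (n i : nat) (F G : nat -> int) : (0 < i < n)%N ->
  (forall a, (0 < a <= n)%N -> a != i -> a != i.+1 -> F a = G a) ->
  \sum_(1 <= a < n.+1) F a - \sum_(1 <= a < n.+1) G a =
  F i + F i.+1 - (G i + G i.+1).
Proof.
move=> hi h; rewrite !(sum_pair _ hi).
have -> : \sum_(1 <= a < i) F a = \sum_(1 <= a < i) G a.
  by apply: eq_big_nat => a ha; apply: h; lia.
have -> : \sum_(i.+2 <= a < n.+1) F a = \sum_(i.+2 <= a < n.+1) G a.
  by apply: eq_big_nat => a ha; apply: h; lia.
lia.
Qed.

Lemma eq_sum2_pair (n i : nat) (X Y : nat -> nat -> int) : (0 < i < n)%N ->
  (forall a b, (0 < a <= n)%N -> (0 < b <= n)%N -> a != i -> a != i.+1 ->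
     b != i -> b != i.+1 -> X a b = Y a b) ->
  (forall a, (0 < a <= n)%N -> a != i -> a != i.+1 ->
     X a i + X a i.+1 + (X i a + X i.+1 a) =
     Y a i + Y a i.+1 + (Y i a + Y i.+1 a)) ->
  \sum_(1 <= a < n.+1) \sum_(1 <= b < n.+1) X a b -
  \sum_(1 <= a < n.+1) \sum_(1 <= b < n.+1) Y a b =
  X i i + X i i.+1 + X i.+1 i + X i.+1 i.+1 -
  (Y i i + Y i i.+1 + Y i.+1 i + Y i.+1 i.+1).
Proof.
move=> hi h1 h2.
pose F (Z : nat -> nat -> int) (a : nat) : int := \sum_(1 <= b < n.+1) Z a b.
pose D (a : nat) : int := if (a == i) || (a == i.+1) then 0 else F X a - F Y a.
pose col (a : nat) : int := X i a + X i.+1 a - (Y i a + Y i.+1 a).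
have e1 : \sum_(1 <= a < n.+1) F X a - \sum_(1 <= a < n.+1) F Y a =
    \sum_(1 <= a < n.+1) D a + \sum_(1 <= a < n.+1) col a.
  rewrite (_ : \sum_(1 <= a < n.+1) col a = F X i + F X i.+1 - (F Y i + F Y i.+1)); last first.
    by rewrite /F -!big_split /= -sumrB.
  have H a : (0 < a <= n)%N -> a != i -> a != i.+1 -> F X a - D a = F Y a.
    by move=> _ /negPf ai /negPf ai1; rewrite /D ai ai1 /=; lia.
  have := @eq_sum_pair n i (fun a => F X a - D a) (F Y) hi H.
  have D1 : D i = 0 by rewrite /D eqxx.
  have D2 : D i.+1 = 0 by rewrite /D eqxx orbT.
  rewrite sumrB D1 D2 !subr0 => <-; rewrite addrAC addrCA.
  by rewrite subrr addr0.
rewrite -[LHS]/(\sum_(1 <= a < n.+1) F X a - \sum_(1 <= a < n.+1) F Y a) e1 -big_split /=.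
have /= := @eq_sum_pair n i (fun a => D a + col a) (fun _ => 0) hi.
rewrite big1_eq addr0 !subr0 => ->.
  by rewrite /D /col !eqxx orbT /=; lia.
move=> a ha ai ai1; rewrite /D (negPf ai) (negPf ai1) /= /F.
rewrite (@eq_sum_pair n i) //.
  by have := h2 a ha ai ai1; rewrite /col; lia.
by move=> b hb bi bi1; apply: h1.
Qed.

(* For the levels x, y of runners a < b, the number of reflections
   exchanging runner a with runner b, resp. with the mirror of b, that are
   left inversions of the minimal representative. *)
Definition pair_inv (x y : int) : int :=
  (if x <= y then y - x else x - y - 1) +
  (if 1 <= x + y then x + y - 1 else - (x + y)).

Definition self_inv (ty : quotient_type) (x : int) : int :=
  match ty with
  | CC => if 1 <= x then 2 * x - 1 else - (2 * x)
  | BB => if 1 <= x then x - 1 else - x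
  | BD => `|x|
  | DD => 0
  end.

Definition inv_entry ty (c : nat -> int) (a b : nat) : int :=
  if (a < b)%N then pair_inv (c a) (c b) else if (a == b) then self_inv ty (c a) else 0.

Definition ninv (ty : quotient_type) (n : nat) (c : nat -> int) : int :=
  \sum_(1 <= a < n.+1) \sum_(1 <= b < n.+1) inv_entry ty c a b.

Lemma ninv_ge0 ty n c : 0 <= ninv ty n c.
Proof.
rewrite /ninv; do 2! (apply: sumr_ge0 => ? _).
rewrite /inv_entry; case: ifP => _.
  by rewrite /pair_inv; do 2! case: ifP => ?; lia.
by case: ifP => // _; case: ty => /=; do ? case: ifP => ?; lia.
Qed.

Lemma eq_ninv ty n c c' : (forall i, (0 < i <= n)%N -> c i = c' i) ->
  ninv ty n c = ninv ty n c'.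
Proof.
move=> h; apply: eq_big_nat => a ha; apply: eq_big_nat => b hb.
by rewrite /inv_entry !h //; lia.
Qed.

Lemma ninv0 ty n : ninv ty n (fun _ => 0) = 0.
Proof.
rewrite /ninv big1 // => a _; rewrite big1 // => b _.
by rewrite /inv_entry /pair_inv; case: ifP => // _; case: ifP => // _; case: ty.
Qed.

Definition inv_step (ty : quotient_type) (n r : nat) (c : nat -> int) : int :=
  if (r == 0)%N then
    if uses_s0D ty then (c 1%N + c 2%N <= 0)%R%:Z - (2 <= c 1%N + c 2%N)%R%:Z
    else (c 1%N <= 0)%R%:Z - (1 <= c 1%N)%R%:Z
  else if (r == n)%N then
    if uses_snD ty then (0 < c n.-1 + c n)%R%:Z - (c n.-1 + c n < 0)%R%:Z
    else (0 < c n)%R%:Z - (c n < 0)%R%:Z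
  else (c r.+1 < c r)%R%:Z - (c r < c r.+1)%R%:Z.

Lemma ninv_act_pair ty n i c c' : (0 < i < n)%N ->
  (forall a, a != i -> a != i.+1 -> c' a = c a) ->
  (forall x, (1 < i)%N -> pair_inv x (c' i) + pair_inv x (c' i.+1) =
     pair_inv x (c i) + pair_inv x (c i.+1)) ->
  (forall x, (i.+1 < n)%N -> pair_inv (c' i) x + pair_inv (c' i.+1) x =
     pair_inv (c i) x + pair_inv (c i.+1) x) ->
  ninv ty n c' - ninv ty n c =
  self_inv ty (c' i) + pair_inv (c' i) (c' i.+1) + self_inv ty (c' i.+1) -
  (self_inv ty (c i) + pair_inv (c i) (c i.+1) + self_inv ty (c i.+1)).
Proof.
move=> hi hc hl hr; rewrite /ninv (@eq_sum2_pair n i) //.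
- rewrite /inv_entry !ltnn !eqxx leqnn.
  have -> : (i.+1 < i)%N = false by lia.
  have -> : (i.+1 == i) = false by lia.
  lia.
- by move=> a b _ _ ai ai1 bi bi1; rewrite /inv_entry !hc.
move=> a ha ai ai1; rewrite /inv_entry (hc a) //.
have -> : (a == i) = false by lia.
have -> : (a == i.+1) = false by lia.
have -> : (i == a) = false by lia.
have -> : (i.+1 == a) = false by lia.
have [al|al] := ltnP a i.
  have -> : (a < i.+1)%N by lia.
  have -> : (i < a)%N = false by lia.
  have -> : (i.+1 < a)%N = false by lia.
  by rewrite !addr0; apply: hl; lia.
have -> : (a < i.+1)%N = false by lia.
have -> : (i < a)%N by lia.
have -> : (i.+1 < a)%N by lia.
by rewrite !add0r; apply: hr; lia.
Qed.

Lemma pair_inv_oppr x y : pair_inv x (- y) = pair_inv x y.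
Proof. by rewrite /pair_inv; do ? case: ifP => ?; lia. Qed.

Lemma pair_inv_flipl x y : pair_inv (1 - x) y = pair_inv x y.
Proof. by rewrite /pair_inv; do ? case: ifP => ?; lia. Qed.

Lemma ninv_act ty n r c : (2 <= n)%N -> (r <= n)%N ->
  ninv ty n (act ty n r c) = ninv ty n c + inv_step ty n r c.
Proof.
move=> n2 rn; suff : ninv ty n (act ty n r c) - ninv ty n c = inv_step ty n r c by lia.
rewrite /inv_step.
have [->|r0] := eqVneq r 0%N.
  rewrite (@ninv_act_pair _ _ 1) //; try lia.
  - by rewrite /act /=; case: ty => /=; rewrite /pair_inv; do ? case: ifP => ?; lia.
  - by move=> a a1 a2; rewrite /act /= (negPf a1) (negPf a2); do ? case: ifP.
  - by move=> x _; rewrite /act /=; case: ifP => _ /=; rewrite !pair_inv_flipl //; lia.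
have [->|rn'] := eqVneq r n.
  have e : n.-1.+1 = n by lia.
  have N0 : (n == 0)%N = false by lia.
  have E : (n == n.-1) = false by lia.
  have E' : (n.-1 == n) = false by lia.
  rewrite (@ninv_act_pair _ _ n.-1) ?e; try lia.
  - rewrite /act N0 eqxx; case: ty => /=; rewrite ?eqxx ?E ?E' /pair_inv;
    do ? case: ifP => ?; lia.
  - move=> a a1 a2; rewrite /act N0 eqxx (negPf a1) (negPf a2).
    by do ? case: ifP.
  - move=> x _; rewrite /act N0 eqxx; case: ifP => _; rewrite ?eqxx ?E ?E' ?pair_inv_oppr //; lia.
rewrite (@ninv_act_pair _ _ r); try lia.
- rewrite /act (negPf r0) (negPf rn') !eqxx; have -> : (r.+1 == r) = false by lia.
  by rewrite /pair_inv; do ? case: ifP => ?; lia.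
- by move=> a a1 a2; rewrite /act (negPf r0) (negPf rn') (negPf a1) (negPf a2).
- by move=> x _; rewrite /act (negPf r0) (negPf rn') !eqxx; have -> : (r.+1 == r) = false by [lia]; lia.
- by move=> x _; rewrite /act (negPf r0) (negPf rn') !eqxx; have -> : (r.+1 == r) = false by [lia]; lia.
Qed.

(** * The first bead right of the reference diagonal *)

(* peel ty n c p r: the first bead right of the reference diagonal is in
   position p, and r is the residue at the end of its row. In [peel_right] this
   bead is on a runner i <= n and in [peel_left] on a runner 2n + 1 - j > n; the
   other constructors are the cases near the diagonals 0 and 2n. *)
Inductive peel (ty : quotient_type) (n : nat) (c : nat -> int) : nat -> nat -> Prop :=
| peel_main : ~~ uses_s0D ty -> 1 <= c 1%N -> peel ty n c 0%N 0%N
| peel_right (i : nat) : ((reference_diag ty).+1 < i <= n)%N ->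
    (forall a : nat, (reference_diag ty < a < i)%N -> c a <= 0) -> 1 <= c i ->
    peel ty n c i.-1 i.-1
| peel_left (j : nat) : (reference_diag ty < j <= n)%N ->
    (forall a : nat, (reference_diag ty < a <= n)%N -> c a <= 0) ->
    (forall a : nat, (j < a <= n)%N -> c a = 0) -> c j < 0 ->
    peel ty n c (2 * n - j)%N (if uses_snD ty && (n.-1 <= j)%N then n else j)
| peel_first : uses_s0D ty -> 1 <= c 2%N ->
    peel ty n c 1%N (if 1 <= c 1%N then 0%N else 1%N)
| peel_neg : uses_s0D ty -> (forall a : nat, (1 < a <= n)%N -> c a = 0) ->
    c 1%N < 0 -> peel ty n c (2 * n)%N.-1 1%N
| peel_pos : uses_s0D ty -> (forall a : nat, (1 < a <= n)%N -> c a = 0) ->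
    2 <= c 1%N -> peel ty n c (2 * n)%N 0%N.

Definition level_sum (n : nat) (c : nat -> int) : nat :=
  (\sum_(1 <= a < n.+1) `|c a|)%N.

Lemma min_rank2 ty n : (min_rank ty <= n)%N -> (2 <= n)%N.
Proof. by case: ty => /=; lia. Qed.

Lemma min_rank3 ty n : (min_rank ty <= n)%N -> uses_s0D ty || uses_snD ty -> (3 <= n)%N.
Proof. by case: ty => //=; lia. Qed.

Lemma level_sum1 n c : (0 < n)%N -> (forall a : nat, (1 < a <= n)%N -> c a = 0) ->
  level_sum n c = `|c 1%N|%N.
Proof.
move=> n0 h; rewrite /level_sum big_ltn // big_nat_cond big1 ?addn0 // => a ha.
by rewrite h //; lia.
Qed.

Lemma peel_exists ty n c : (2 <= n)%N -> (uses_s0D ty -> ~~ odd (level_sum n c)) ->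
  (forall i : nat, (0 < i <= n)%N -> c i = 0) \/ exists p r, peel ty n c p r.
Proof.
move=> n2 par; pose rho := reference_diag ty.
have rho1 : (rho <= 1)%N by rewrite /rho /reference_diag; case: ifP.
pose P := [pred i : nat | [&& (rho < i)%N, (i <= n)%N & 1 <= c i]].
case: (boolP (has P (iota 1 n))) => [/hasP [x _ Px]|/hasPn noP].
  right; have exP : exists i, P i by exists x.
  case: (ex_minnP exP) => i /and3P[i1 i2 i3] imin.
  have small (a : nat) : (rho < a < i)%N -> c a <= 0.
    move=> ha; have [//|ca] := leP (c a) 0.
    by have := imin a ltac:(rewrite /= /P /=; lia); lia.
  have [ie|ine] := eqVneq i rho.+1; last first.
    by exists i.-1, i.-1; apply: peel_right => //; rewrite -/rho; lia.
  move: ie i3; rewrite /rho /reference_diag; case: (boolP (uses_s0D ty)) => us -> ci.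
    by exists 1%N, (if 1 <= c 1%N then 0%N else 1%N); apply: peel_first.
  by exists 0%N, 0%N; apply: peel_main.
have np (a : nat) : (rho < a <= n)%N -> c a <= 0.
  move=> ha; have := noP a; rewrite mem_iota => /(_ ltac:(lia)) /=; lia.
pose Q := [pred i : nat | [&& (rho < i)%N, (i <= n)%N & c i < 0]].
case: (boolP (has Q (iota 1 n))) => [/hasP [x _ Qx]|/hasPn noQ].
  right; have exQ : exists i, Q i by exists x.
  have leQ i : Q i -> (i <= n)%N by case/and3P.
  case: (ex_maxnP exQ leQ) => j /and3P[j1 j2 j3] jmax.
  exists (2 * n - j)%N, (if uses_snD ty && (n.-1 <= j)%N then n else j).
  apply: peel_left => //; first by rewrite -/rho; lia.
  move=> a ha; have := np a ltac:(lia); have [ca|] := ltP (c a) 0; last by lia.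
  by have := jmax a ltac:(rewrite /= /Q /=; lia); lia.
have z (a : nat) : (rho < a <= n)%N -> c a = 0.
  move=> ha; have := np a ha; have := noQ a; rewrite mem_iota => /(_ ltac:(lia)) /=; lia.
case: (boolP (uses_s0D ty)) => us; last first.
  by left=> i hi; apply: z; rewrite /rho /reference_diag (negPf us).
have z' (a : nat) : (1 < a <= n)%N -> c a = 0.
  by move=> ha; apply: z; rewrite /rho /reference_diag us.
have := par us; rewrite (level_sum1 _ z'); last by lia.
have [c1|c1] := ltP (c 1%N) 0.
  by right; exists (2 * n).-1, 1%N; apply: peel_neg.
have [c2|c2] := leP 2 (c 1%N).
  by right; exists (2 * n)%N, 0%N; apply: peel_pos.
move=> od; left=> i hi; have [->|i1] := eqVneq i 1%N; first by lia.
by apply: z'; lia.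
Qed.

Lemma pbead_lt n c (p : nat) : (p < n)%N -> pbead n c p%:Z = (1 <= c p.+1).
Proof.
move=> pn; have := @pbead_rep n c 0 p ltac:(lia).
by rewrite mul0r add0r pn.
Qed.

Lemma pbead_ge n c (p : nat) : (n <= p < 2 * n)%N ->
  pbead n c p%:Z = (1 <= - c (2 * n - p)%N).
Proof.
move=> pn; have := @pbead_rep n c 0 p ltac:(lia).
by rewrite mul0r add0r; have -> : (p < n)%N = false by lia.
Qed.

Lemma pbead_2n n c : (0 < n)%N -> pbead n c (2 * n)%N%:Z = (2 <= c 1%N).
Proof.
move=> n0; have := @pbead_rep n c 1 0 ltac:(lia).
by rewrite mul1r addr0 n0.
Qed.

Definition first_bead ty n c (p : nat) : Prop :=
  [/\ (reference_diag ty <= p <= 2 * n)%N, pbead n c p%:Z &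
      forall x : nat, (reference_diag ty <= x < p)%N -> ~~ pbead n c x%:Z].

Lemma first_bead_right ty n c (i : nat) : (reference_diag ty < i <= n)%N ->
  (forall a : nat, (reference_diag ty < a < i)%N -> c a <= 0) -> 1 <= c i ->
  first_bead ty n c i.-1.
Proof.
move=> hi h ci; split; first by lia.
  by rewrite pbead_lt; last lia; have -> : i.-1.+1 = i by lia.
move=> x hx; rewrite pbead_lt; last by lia.
by have := h x.+1 ltac:(lia); lia.
Qed.

Lemma first_bead_left ty n c (j : nat) : (reference_diag ty < j <= n)%N ->
  (forall a : nat, (reference_diag ty < a <= n)%N -> c a <= 0) ->
  (forall a : nat, (j < a <= n)%N -> c a = 0) -> c j < 0 ->
  first_bead ty n c (2 * n - j).
Proof.
move=> hj h z cj; split; first by lia.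
  by rewrite pbead_ge; last lia; have -> : (2 * n - (2 * n - j))%N = j by [lia]; lia.
move=> x hx; have [xn|xn] := ltnP x n.
  by rewrite pbead_lt //; have := h x.+1 ltac:(lia); lia.
by rewrite pbead_ge; last lia; rewrite z; lia.
Qed.

Lemma peel_first_bead ty n c p r : (2 <= n)%N -> peel ty n c p r -> first_bead ty n c p.
Proof.
move=> n2; case=> {p r}.
- move=> us c1; split; rewrite ?pbead_lt //; try lia.
  by rewrite /reference_diag (negPf us).
- by move=> i hi h ci; apply: first_bead_right => //; lia.
- by move=> j hj h z cj; apply: first_bead_left.
- by move=> us c2; split; rewrite /reference_diag ?us ?pbead_lt //; lia.
- move=> us z c1; split; rewrite /reference_diag ?us; first by lia.
    by rewrite pbead_ge; last lia; have -> : (2 * n - (2 * n).-1 = 1)%N by [lia]; lia.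
  move=> x hx; have [xn|xn] := ltnP x n; first by rewrite pbead_lt // z; lia.
  by rewrite pbead_ge; last lia; rewrite z; lia.
- move=> us z c1; split; rewrite /reference_diag ?us; first by lia.
    by rewrite pbead_2n; lia.
  move=> x hx; have [xn|xn] := ltnP x n; first by rewrite pbead_lt // z; lia.
  rewrite pbead_ge; last lia; have [e|e] := eqVneq x (2 * n).-1.
    by have -> : (2 * n - x = 1)%N by [lia]; lia.
  by rewrite z; lia.
Qed.

Lemma peel_le ty n c p r : (2 <= n)%N -> peel ty n c p r -> (r <= n)%N.
Proof. by move=> n2; case=> {p r} *; do ? case: ifP => ?; lia. Qed.

Lemma peel_inv_step ty n c p r : (min_rank ty <= n)%N -> peel ty n c p r ->
  inv_step ty n r c = -1.
Proof.
move=> hn; have n2 := min_rank2 hn; have n3 := min_rank3 hn.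
case=> {p r}; rewrite /inv_step.
- by move=> us c1; rewrite eqxx (negPf us); lia.
- move=> i hi h ci; have -> : (i.-1 == 0)%N = false by lia.
  have -> : (i.-1 == n) = false by lia.
  by have -> : i.-1.+1 = i by [lia]; have := h i.-1 ltac:(lia); lia.
- move=> j hj h z cj; case: (boolP (uses_snD ty && (n.-1 <= j)%N)) => [/andP[us jn]|hb].
    rewrite us orbT in n3; have {}n3 := n3 isT.
    have -> : (n == 0)%N = false by lia.
    rewrite eqxx us; have [e|e] := eqVneq j n.
      by subst j; have := h n.-1 ltac:(move: hj; rewrite /reference_diag; case: ifP; lia); lia.
    have e' : j = n.-1 by lia.
    by rewrite -e' (z n); lia.
  have -> : (j == 0)%N = false by lia.
  have [e|e] := eqVneq j n; last by rewrite (z j.+1); lia.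
  subst j; have -> : uses_snD ty = false by move: hb; case: (uses_snD ty) => //=; lia.
  lia.
- move=> us c2; rewrite us in n3; have {}n3 := n3 isT.
  case: (leP 1 (c 1%N)) => c1 /=; first by rewrite us; lia.
  by have -> : (1 == n)%N = false by [lia]; lia.
- move=> us z c1; rewrite us in n3; have {}n3 := n3 isT.
  by have -> /= : (1 == n)%N = false by [lia]; rewrite z; lia.
- by move=> us z c1; rewrite us /= (z 2%N); lia.
Qed.

(** * Residues at the end of a row *)

Lemma band_pos_row n m d p (k : int) (v : nat) : (v < 2 * n)%N ->
  p%:Z - m%:Z + 1 = k * (2 * n)%:Z + v%:Z -> band_pos n m (d, (d + p)%N) = v.
Proof.
move=> hv e; rewrite /band_pos /diag /=.
have -> : (d + p)%N%:Z - d%:Z - m%:Z + 1 = k * (2 * n)%:Z + v%:Z by lia.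
by rewrite modzMDl modz_small; lia.
Qed.

Lemma band_residues_row n m a b la d p t : row_len la d = (d + p)%N -> (0 < p)%N ->
  (t <= p)%N -> band_pos n m (d, (d + p)%N) = t ->
  band_residues n m a b la (d, (d + p)%N) =
  nth [::] [:: [:: a]; [:: b]; [:: a; b]] t.
Proof.
move=> hL p0 tp ht; rewrite /band_residues /=.
have -> : (d < d + p)%N by lia.
rewrite /upper_residues /= ht hL /residue_triple.
have -> : ((d + p).+1 == d + p - t)%N = false by lia.
case: t ht tp => [|[|[|t]]] _ tp.
- by rewrite subn0 eqxx.
- have -> : (d + p == d + p - 1)%N = false by lia.
  by have -> : (d + p == (d + p - 1).+1)%N by lia.
- have -> : (d + p == d + p - 2)%N = false by lia.
  have -> : (d + p == (d + p - 2).+1)%N = false by lia.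
  by have -> : (d + p == (d + p - 2).+2)%N by lia.
have -> : (d + p == d + p - t.+3)%N = false by lia.
have -> : (d + p == (d + p - t.+3).+1)%N = false by lia.
have -> : (d + p == (d + p - t.+3).+2)%N = false by lia.
by rewrite /= !nth_nil.
Qed.

Section RowEnd.

Variables (ty : quotient_type) (n d p : nat) (la : seq nat).
Hypotheses (hn : (min_rank ty <= n)%N) (d0 : (0 < d)%N).
Hypothesis hL : row_len la d = (d + p)%N.

Lemma residues_escalator : uses_snD ty -> (n.-1 <= p <= n.+1)%N ->
  residues ty n la (d, (d + p)%N) =
  nth [::] [:: [:: n.-1]; [:: n]; [:: n.-1; n]] (p - n.-1).
Proof.
move=> us hp; have n2 := min_rank2 hn.
have bp : band_pos n n (d, (d + p)%N) = (p - n.-1)%N.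
  by apply: (@band_pos_row _ _ _ _ 0); lia.
rewrite /residues us /in_band /= d0 bp.
have -> : (0 < d + p)%N by lia.
have -> /= : (p - n.-1 < 3)%N by lia.
by apply: band_residues_row; lia.
Qed.

Lemma escalator_out : (p <= 2 * n)%N -> (3 <= n)%N -> ~~ (n.-1 <= p <= n.+1)%N ->
  in_band n n (d, (d + p)%N) = false.
Proof.
move=> pn n3 hp; rewrite /in_band.
have [pl|pl] := ltnP p n.-1.
  by rewrite (@band_pos_row _ _ _ _ (- 1) (p + n.+1)); lia.
by rewrite (@band_pos_row _ _ _ _ 0 (p - n.-1)); lia.
Qed.

Lemma descalator_out : (0 < n)%N -> (1 < p < (2 * n).-1)%N ->
  in_band n 0 (d, (d + p)%N) = false.
Proof.
move=> n0 hp; rewrite /in_band.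
by rewrite (@band_pos_row _ _ _ _ 0 p.+1); lia.
Qed.

Lemma residues_main : uses_s0D ty -> p = 1%N ->
  residues ty n la (d, (d + p)%N) = [:: if odd d then 0%N else 1%N].
Proof.
move=> us p1; have n3 := min_rank3 hn; rewrite us in n3; have {}n3 := n3 isT.
have n4 : uses_snD ty -> (4 <= n)%N by move: hn us; case: ty => //=; lia.
rewrite /residues.
have -> : uses_snD ty && in_band n n (d, (d + p)%N) = false.
  case: (uses_snD ty) n4 => //= /(_ isT) n4.
  by apply: escalator_out => //; lia.
have -> : in_band n 0 (d, (d + p)%N).
  by rewrite /in_band (@band_pos_row _ _ _ _ 0 p.+1) /=; lia.
rewrite us /=; have -> : main_descalator (d, (d + p)%N).
  by rewrite /main_descalator /diag /=; lia.
rewrite /main_residue /=; have -> : (d == d + p)%N = false by lia.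
rewrite p1; case: (boolP (odd d)) => hd.
  by have -> : ((d + (d + 1)) %% 4 == 1)%N = false by lia.
by have -> : ((d + (d + 1)) %% 4 == 1)%N by lia.
Qed.

Lemma residues_descalator : uses_s0D ty -> ((2 * n).-1 <= p <= 2 * n)%N ->
  residues ty n la (d, (d + p)%N) = [:: if p == (2 * n)%N then 0%N else 1%N].
Proof.
move=> us hp; have n3 := min_rank3 hn; rewrite us in n3; have {}n3 := n3 isT.
rewrite /residues escalator_out; try lia; rewrite andbF us.
have bp : band_pos n 0 (d, (d + p)%N) = (p - (2 * n).-1)%N.
  by apply: (@band_pos_row _ _ _ _ 1); lia.
have -> : in_band n 0 (d, (d + p)%N) by rewrite /in_band bp /=; lia.
have -> : main_descalator (d, (d + p)%N) = false.
  by rewrite /main_descalator /diag /=; lia.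
rewrite /= (@band_residues_row _ _ _ _ _ _ _ _ hL _ _ bp); try lia.
have [->|pn] := eqVneq p (2 * n)%N; first by have -> : (2 * n - (2 * n).-1 = 1)%N by lia.
by have -> : (p - (2 * n).-1 = 0)%N by lia.
Qed.

Lemma residues_fixed : (p < 2 * n)%N ->
  (uses_snD ty -> ~~ (n.-1 <= p <= n.+1)%N) ->
  (uses_s0D ty -> (1 < p < (2 * n).-1)%N) ->
  residues ty n la (d, (d + p)%N) = [:: if (p <= n)%N then p else (2 * n - p)%N].
Proof.
move=> pn h1 h2; have n2 := min_rank2 hn; rewrite /residues.
have -> : uses_snD ty && in_band n n (d, (d + p)%N) = false.
  have := min_rank3 hn; case: (uses_snD ty) h1 => //= /(_ isT) h1 n3.
  by apply: escalator_out => //; [lia | apply: n3; rewrite orbT].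
have -> : uses_s0D ty && in_band n 0 (d, (d + p)%N) = false.
  by case: (uses_s0D ty) h2 => //= /(_ isT) h2; apply: descalator_out; lia.
rewrite /fixed_residue /diag_mod /diag /=.
have -> : (d + p)%N%:Z - d%:Z = p%:Z by lia.
by rewrite modz_small //; lia.
Qed.

Lemma peeling_residue1 r r' : residues ty n la (d, row_len la d) = [:: r] ->
  peeling_residue ty n la (d, row_len la d) r' <-> r' = r.
Proof.
move=> e; have n2 := min_rank2 hn; rewrite /peeling_residue e !inE; split=> [[/eqP]//|->].
by rewrite eqxx; split=> // /eqP; lia.
Qed.

Lemma peeling_residueP c r r' : peel ty n c p r ->
  (uses_s0D ty -> p = 1%N -> odd d = (1 <= c 1%N)) ->
  peeling_residue ty n la (d, row_len la d) r' <-> r' = r.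
Proof.
have n2 := min_rank2 hn; have n3 := min_rank3 hn.
move=> hp; case: {-1}_ {-1}_ / hp (erefl p) (erefl r).
- move=> us c1 ep er _; apply: peeling_residue1; rewrite hL residues_fixed //; try lia.
    by rewrite ep.
- move=> i hi h ci ep er _.
  have [/andP[us e]|hb] := boolP (uses_snD ty && (n.-1 == p)%N).
    apply: peeling_residue1; rewrite hL residues_escalator //; last by lia.
    by have -> : (p - n.-1 = 0)%N by [lia]; rewrite /= (eqP e) ep.
  apply: peeling_residue1; rewrite hL residues_fixed.
  - by congr [:: _]; case: ifP; lia.
  - lia.
  - by move=> us; move: hb; rewrite us /=; lia.
  - by move=> us; move: hi; rewrite /reference_diag us; lia.
- move=> j hj h z cj ep er _.
  have [/andP[us jn]|hb] := boolP (uses_snD ty && (n.-1 <= j)%N).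
    rewrite us orbT in n3; have {}n3 := n3 isT.
    rewrite /= {er}.
    have [e|e] := eqVneq j n.
      apply: peeling_residue1; rewrite hL residues_escalator //; last by lia.
      by have -> : (p - n.-1 = 1)%N by lia.
    rewrite /peeling_residue hL residues_escalator //; last by lia.
    have -> /= : (p - n.-1 = 2)%N by lia.
    rewrite !inE !eqxx orbT; split=> [[_ ->]//|->].
    by rewrite eqxx orbT.
  rewrite /= {er}.
  apply: peeling_residue1; rewrite hL residues_fixed.
  - by congr [:: _]; case: ifP; lia.
  - lia.
  - by move=> us; move: hb; rewrite us /=; lia.
  - by move=> us; move: hj n3; rewrite /reference_diag us /=; lia.
- move=> us c2 ep er /(_ us erefl) od; apply: peeling_residue1.
  by rewrite hL residues_main // od.
- move=> us z c1 ep er _; apply: peeling_residue1.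
  rewrite hL residues_descalator //; last by lia.
  by have -> : (p == 2 * n)%N = false by lia.
- move=> us z c1 ep er _; apply: peeling_residue1.
  rewrite hL residues_descalator //; last by lia.
  by have -> : (p == 2 * n)%N by lia.
Qed.

End RowEnd.

(** * The effect of a peeling step *)

Lemma level_sumE n c : (level_sum n c)%:Z = \sum_(1 <= a < n.+1) `|c a|.
Proof.
rewrite /level_sum (big_morph Posz PoszD (erefl _)).
by apply: eq_bigr => a _; rewrite abszE.
Qed.

Lemma level_sum_pair n i c c' : (0 < i < n)%N ->
  (forall a, a != i -> a != i.+1 -> c' a = c a) ->
  (level_sum n c')%:Z - (level_sum n c)%:Z =
  `|c' i| + `|c' i.+1| - (`|c i| + `|c i.+1|).
Proof.
move=> hi h; rewrite !level_sumE (@eq_sum_pair n i) //.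
by move=> a _ ai ai1; rewrite h.
Qed.

Lemma act_mid ty n r c a : (0 < r < n)%N -> act ty n r c a =
  if (a == r)%N then c r.+1 else if (a == r.+1)%N then c r else c a.
Proof.
move=> hr; rewrite /act; have -> : (r == 0)%N = false by lia.
by have -> : (r == n)%N = false by lia.
Qed.

Lemma act_nC ty n c a : (0 < n)%N -> ~~ uses_snD ty -> act ty n n c a =
  if (a == n)%N then - c n else c a.
Proof.
move=> n0 us; rewrite /act; have -> : (n == 0)%N = false by lia.
by rewrite eqxx (negPf us).
Qed.

Lemma act_nD ty n c a : (0 < n)%N -> uses_snD ty -> act ty n n c a =
  if (a == n.-1)%N then - c n else if (a == n)%N then - c n.-1 else c a.
Proof.
move=> n0 us; rewrite /act; have -> : (n == 0)%N = false by lia.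
by rewrite eqxx us.
Qed.

Definition ref_level_sum ty n c : nat :=
  (level_sum n c - (uses_s0D ty && (1 <= c 1%N)%R))%N.

Definition two_box ty n r : bool :=
  uses_snD ty && (r == n)%N || uses_s0D ty && (r == 0)%N.

Lemma level_sum_ge1 n c : (0 < n)%N -> (`|c 1%N| <= level_sum n c)%N.
Proof. by move=> n0; rewrite /level_sum big_ltn // leq_addr. Qed.

Lemma ref_level_sumE ty n c : (0 < n)%N -> (ref_level_sum ty n c)%:Z =
  (level_sum n c)%:Z - (uses_s0D ty && (1 <= c 1%N)%R)%:Z.
Proof.
by move=> n0; rewrite /ref_level_sum; have := level_sum_ge1 c n0; lia.
Qed.

Lemma ref_level_sum_eq ty n c c' : (0 < n)%N ->
  (level_sum n c')%:Z - (uses_s0D ty && (1 <= c' 1%N)%R)%:Z =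
  (level_sum n c)%:Z - (uses_s0D ty && (1 <= c 1%N)%R)%:Z ->
  ref_level_sum ty n c' = ref_level_sum ty n c.
Proof. by move=> n0; rewrite -!ref_level_sumE // => -[]. Qed.

Lemma peel_next ty n c p r : (min_rank ty <= n)%N -> peel ty n c p r ->
  let c' := act ty n r c in let k := (two_box ty n r).+1 in
  [\/ [/\ (k <= p)%N, first_bead ty n c' (p - k),
          ref_level_sum ty n c' = ref_level_sum ty n c
        & two_box ty n r -> (r == n)%N && (n <= p <= n.+1)%N && uses_snD ty
                         || (r == 0)%N && (p == 2 * n)%N],
      ~~ two_box ty n r /\ ref_level_sum ty n c = (ref_level_sum ty n c').+1
    | [/\ uses_s0D ty, r = 0%N, p = 1%N,
          ref_level_sum ty n c = (ref_level_sum ty n c').+1 & c' 1%N <= 0] ].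
Proof.
move=> hn hp; have n2 := min_rank2 hn; have n3 := min_rank3 hn.
have n0 : (0 < n)%N by lia.
move=> c' k; rewrite /c' /k {c' k}.
have e : n.-1.+1 = n by lia.
have E : (n == n.-1) = false by lia.
case: hp => {p r}.
- move=> us c1; have dn : two_box ty n 0 = false.
    by rewrite /two_box (negPf us); have -> : (0 == n)%N = false by [lia]; rewrite !andbF.
  rewrite dn; apply: Or32; split=> //.
  have a1 a : act ty n 0 c a = if (a == 1)%N then 1 - c 1%N else c a.
    by rewrite /act /= (negPf us).
  suff : (ref_level_sum ty n c)%:Z = (ref_level_sum ty n (act ty n 0 c)).+1%:Z by case.
  rewrite -addn1 PoszD !ref_level_sumE // (negPf us) !a1 /=.
  have := @level_sum_pair n 1 c (act ty n 0 c) ltac:(lia).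
  rewrite !a1 /= => H; have {}H := H ltac:(by move=> a; rewrite a1; case: eqP).
  lia.
- move=> i hi h ci.
  have ri : (1 < i <= n)%N by lia.
  have dn : two_box ty n i.-1 = false by rewrite /two_box; lia.
  rewrite dn; apply: Or31; split=> //; first by lia.
    have -> : (i.-1 - 1 = i.-1.-1)%N by lia.
    apply: first_bead_right; first by lia.
      by move=> a ha; rewrite act_mid ?ifF; try lia; apply: h; lia.
    by rewrite act_mid ?eqxx; try lia; have -> : i.-1.+1 = i by lia.
  apply: ref_level_sum_eq => //.
  have := @level_sum_pair n i.-1 c (act ty n i.-1 c) ltac:(lia).
  have ei : i.-1.+1 = i by lia.
  have A a : act ty n i.-1 c a = if (a == i.-1)%N then c i else if (a == i)%N then c i.-1 else c a.
    by rewrite act_mid ?ei //; lia.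
  rewrite ei !A !eqxx; have -> : (i == i.-1) = false by lia.
  move=> H; have {}H := H ltac:(by move=> a; rewrite A; case: eqP => // _; case: eqP).
  have := h i.-1; rewrite /reference_diag; move: hi; rewrite /reference_diag.
  case: (uses_s0D ty) => /= hi h1; last by lia.
  have -> : (1 == i.-1)%N = false by lia.
  by have -> : (1 == i)%N = false by [lia]; lia.
- move=> j hj h z cj.
  have [/andP[us jn]|hb] := boolP (uses_snD ty && (n.-1 <= j)%N).
    rewrite us orbT in n3; have {}n3 := n3 isT.
    have dn : two_box ty n n by rewrite /two_box us eqxx.
    rewrite dn; apply: Or31; split; first by lia.
    + have [ej|ej] := eqVneq j n.
        have -> : (2 * n - j - 2 = n.-1.-1)%N by lia.
        apply: first_bead_right; first by move: hj; rewrite /reference_diag; case: ifP; lia.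
          move=> a ha; rewrite act_nD //; have -> : (a == n.-1) = false by lia.
          by have -> : (a == n) = false by [lia]; apply: h; lia.
        by rewrite act_nD // eqxx -ej; lia.
      have -> : (2 * n - j - 2 = n.-1)%N by lia.
      have ej' : n.-1 = j by lia.
      apply: first_bead_right; first by lia.
        move=> a ha; rewrite act_nD //; have [an|an] := eqVneq a n.-1; first by rewrite z; lia.
        by have -> : (a == n) = false by [lia]; apply: h; lia.
      by rewrite act_nD // E eqxx ej'; lia.
    + apply: ref_level_sum_eq => //.
      have := @level_sum_pair n n.-1 c (act ty n n c) ltac:(lia).
      rewrite e !act_nD // !eqxx E; have -> : (1 == n.-1)%N = false by lia.
      have -> : (1 == n)%N = false by lia.
      move=> H; have {}H := H ltac:(by move=> a; rewrite act_nD //; case: eqP => // _; case: eqP).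
      lia.
    + by rewrite eqxx us andbT => _; lia.
  have dn : two_box ty n j = false.
    rewrite /two_box; have -> : (j == 0)%N = false by lia.
    by move: hb; case: (uses_snD ty) => /=; lia.
  rewrite dn; apply: Or31; split=> //; first by lia.
    have [ej|ej] := eqVneq j n.
      have us : ~~ uses_snD ty by [move: hb; case: (uses_snD ty) => //=; lia].
      have -> : (2 * n - j - 1 = n.-1)%N by lia.
      rewrite ej; apply: first_bead_right; first by lia.
        move=> a ha; rewrite act_nC //; have -> : (a == n) = false by lia.
        by apply: h; lia.
      by rewrite act_nC // eqxx -ej; lia.
    have -> : (2 * n - j - 1 = 2 * n - j.+1)%N by lia.
    apply: first_bead_left; first by lia.
    + move=> a ha; rewrite act_mid; last by lia.
      by case: eqP => ?; [rewrite z; lia | case: eqP => ?; [lia | apply: h]].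
    + move=> a ha; rewrite act_mid; last by lia.
      have -> : (a == j) = false by lia.
      by have -> : (a == j.+1) = false by [lia]; rewrite z; lia.
    + rewrite act_mid; last by lia.
      by rewrite eqxx; have -> : (j.+1 == j) = false by lia.
  apply: ref_level_sum_eq => //.
  have [ej|ej] := eqVneq j n.
    have us : ~~ uses_snD ty by [move: hb; case: (uses_snD ty) => //=; lia].
    have := @level_sum_pair n n.-1 c (act ty n j c) ltac:(lia).
    rewrite ej e !act_nC // !eqxx; have -> : (n.-1 == n)%N = false by lia.
    have -> : (1 == n)%N = false by lia.
    move=> H; have {}H := H ltac:(by move=> a _ /negPf an; rewrite act_nC // an).
    lia.
  have := @level_sum_pair n j c (act ty n j c) ltac:(lia).
  have A a := @act_mid ty n j c a ltac:(lia).
  rewrite !A !eqxx; have -> : (j.+1 == j)%N = false by lia.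
  move=> H; have {}H := H ltac:(by move=> a; rewrite A; case: eqP => // _; case: eqP).
  move: hj; rewrite /reference_diag; case: (uses_s0D ty) => hj; last by lia.
  have -> : (1 == j)%N = false by lia.
  by have -> : (1 == j.+1)%N = false by [lia]; lia.
- move=> us c2; rewrite us in n3; have {}n3 := n3 isT.
  case: (leP 1 (c 1%N)) => c1.
    have A a : act ty n 0 c a = if (a == 1)%N then 1 - c 2%N else if (a == 2)%N then 1 - c 1%N else c a.
      by rewrite /act us.
    apply: Or33; split=> //; last by rewrite A /=; lia.
    suff : (ref_level_sum ty n c)%:Z = (ref_level_sum ty n (act ty n 0 c)).+1%:Z by case.
    rewrite -addn1 PoszD !ref_level_sumE // us !A /=.
    have := @level_sum_pair n 1 c (act ty n 0 c) ltac:(lia).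
    rewrite !A /= => H; have {}H := H ltac:(by move=> a; rewrite A; case: eqP => // _; case: eqP).
    lia.
  have dn : two_box ty n 1 = false by rewrite /two_box andbF; lia.
  rewrite dn; apply: Or32; split=> //.
  have A a := @act_mid ty n 1 c a ltac:(lia).
  suff : (ref_level_sum ty n c)%:Z = (ref_level_sum ty n (act ty n 1 c)).+1%:Z by case.
  rewrite -addn1 PoszD !ref_level_sumE // us !A /=.
  have := @level_sum_pair n 1 c (act ty n 1 c) ltac:(lia).
  rewrite !A /= => H; have {}H := H ltac:(by move=> a; rewrite A; case: eqP => // _; case: eqP).
  lia.
- move=> us z c1; rewrite us in n3; have {}n3 := n3 isT.
  have dn : two_box ty n 1 = false by rewrite /two_box andbF; lia.
  have A a := @act_mid ty n 1 c a ltac:(lia).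
  rewrite dn; apply: Or31; split=> //; first by lia.
    have -> : ((2 * n).-1 - 1 = 2 * n - 2)%N by lia.
    apply: first_bead_left; rewrite /reference_diag ?us; first by lia.
    + move=> a ha; rewrite A; case: eqP => [|_]; first by lia.
      by case: eqP => [|_]; [lia | rewrite z; lia].
    + move=> a ha; rewrite A; case: eqP => [|_]; first by lia.
      by case: eqP => [|_]; [lia | rewrite z; lia].
    + by rewrite A.
  apply: ref_level_sum_eq => //; rewrite us !A /=.
  have := @level_sum_pair n 1 c (act ty n 1 c) ltac:(lia).
  rewrite !A /= => H; have {}H := H ltac:(by move=> a; rewrite A; case: eqP => // _; case: eqP).
  by have := z 2%N ltac:(lia); lia.
- move=> us z c1; rewrite us in n3; have {}n3 := n3 isT.
  have dn : two_box ty n 0 by rewrite /two_box us eqxx orbT.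
  have A a : act ty n 0 c a = if (a == 1)%N then 1 - c 2%N else if (a == 2)%N then 1 - c 1%N else c a.
    by rewrite /act us.
  rewrite dn; apply: Or31; split; first by lia.
  + apply: first_bead_left; rewrite /reference_diag ?us; first by lia.
    * move=> a ha; rewrite A; case: eqP => [|_]; first by lia.
      by case: eqP => [|_]; [lia | rewrite z; lia].
    * move=> a ha; rewrite A; case: eqP => [|_]; first by lia.
      by case: eqP => [|_]; [lia | rewrite z; lia].
    * by rewrite A /=; lia.
  + apply: ref_level_sum_eq => //; rewrite us !A /=.
    have := @level_sum_pair n 1 c (act ty n 0 c) ltac:(lia).
    rewrite !A /= => H; have {}H := H ltac:(by move=> a; rewrite A; case: eqP => // _; case: eqP).
    by have := z 2%N ltac:(lia); lia.
  + by rewrite !eqxx orbT.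
Qed.

Lemma level_sum_act_odd ty n r c : (2 <= n)%N -> (r <= n)%N -> uses_s0D ty ->
  odd (level_sum n (act ty n r c)) = odd (level_sum n c).
Proof.
move=> n2 rn us; have e : n.-1.+1 = n by lia.
have [r0|r0] := eqVneq r 0%N.
  have A a : act ty n r c a = if (a == 1)%N then 1 - c 2%N else if (a == 2)%N then 1 - c 1%N else c a.
    by rewrite /act r0 us.
  have := @level_sum_pair n 1 c (act ty n r c) ltac:(lia).
  rewrite !A /= => H; have {}H := H ltac:(by move=> a /negPf a1 /negPf a2; rewrite A a1 a2).
  by lia.
have [rn'|rn'] := eqVneq r n.
  have := @level_sum_pair n n.-1 c (act ty n r c) ltac:(lia).
  rewrite rn' e; case: (boolP (uses_snD ty)) => us' H.
    have {}H := H ltac:(by move=> a /negPf a1 /negPf a2; rewrite act_nD ?a1 ?a2 //; lia).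
    rewrite !act_nD ?eqxx in H; try lia.
    by have E : (n == n.-1) = false by [lia]; rewrite E in H; lia.
  have {}H := H ltac:(by move=> a /negPf a1 /negPf a2; rewrite act_nC ?a1 ?a2 //; lia).
  rewrite !act_nC ?eqxx in H; try lia.
  by have E : (n.-1 == n) = false by [lia]; rewrite E in H; lia.
have := @level_sum_pair n r c (act ty n r c) ltac:(lia).
have A a := @act_mid ty n r c a ltac:(lia).
rewrite !A !eqxx => H; have {}H := H ltac:(by move=> a /negPf a1 /negPf a2; rewrite A a1 a2).
by have E : (r.+1 == r) = false by [lia]; rewrite E in H; lia.
Qed.

Lemma odd_ref_level_sum ty n c : (0 < n)%N -> uses_s0D ty ->
  ~~ odd (level_sum n c) -> odd (ref_level_sum ty n c) = (1 <= c 1%N).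
Proof.
by move=> n0 us; rewrite /ref_level_sum us; have := level_sum_ge1 c n0; lia.
Qed.

Definition bounded (n k : nat) (c : nat -> int) : Prop :=
  (2 <= k)%N /\ forall i : nat, (0 < i <= n)%N -> (`|c i| < k)%N.

Definition core_of (n k : nat) (c : nat -> int) : seq nat :=
  rows_of (psteps n c (k * (2 * n))).

Lemma ref_count_core_of ty n k c : (0 < n)%N -> bounded n k c ->
  ref_count ty (core_of n k c) = ref_level_sum ty n c.
Proof.
move=> n0 [k2 hc]; rewrite ref_count_nbeads // /ref_level_sum /reference_diag.
have h0 := @nbeads0 n c k n0 (fun i hi => ltnW (hc i hi)).
rewrite -/(level_sum n c) in h0.
case: (uses_s0D ty); last by rewrite h0 subn0.
have := @nbeads_S n c (k * (2 * n)) 0 ltac:(nia).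
by rewrite h0 add0r => ->; rewrite pbead_lt //= addnC addnK.
Qed.

Lemma first_bead_row ty n k c p : (0 < n)%N -> bounded n k c ->
  first_bead ty n c p ->
  (0 < ref_count ty (core_of n k c))%N /\
  row_len (core_of n k c) (ref_count ty (core_of n k c)) =
    (ref_count ty (core_of n k c) + p)%N.
Proof.
move=> n0 [k2 hc] [hp bp np]; rewrite ref_count_nbeads //.
rewrite (@nbeads_eq n c _ _ p%:Z); first last.
- move=> x hx; have := np `|x|%N; have -> : `|x|%N%:Z = x by lia.
  by apply; lia.
- by lia.
have [h1 h2] := @row_len_bead n c (k * (2 * n)) p%:Z n0 ltac:(nia) bp.
split=> //.
by move: h2; rewrite -/(core_of n k c); lia.
Qed.

Lemma removed_boxes2 d la mu y : row_len la d = y.+2 -> row_len mu d = y ->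
  removed_boxes d la mu = [:: (d, y.+1); (d, y.+2)].
Proof.
by move=> h1 h2; rewrite /removed_boxes h1 h2; have -> : (y.+2 - y = 2)%N by lia.
Qed.

Lemma recorded_peel ty n k c p r (c' := act ty n r c)
    (la := core_of n k c) (mu := core_of n k c') (d := ref_count ty la) :
  (min_rank ty <= n)%N -> peel ty n c p r -> bounded n k c -> bounded n k c' ->
  exists y, [/\ recorded ty n d r la mu = [:: (d, y)], (y <= row_len la d)%N &
    (ref_count ty mu < d)%N \/ ref_count ty mu = d /\ (row_len mu d < y)%N].
Proof.
move=> hn hp hc hc'; have n2 := min_rank2 hn; have n0 : (0 < n)%N by lia.
have fb := peel_first_bead n2 hp.
have [d0 rl] := first_bead_row n0 hc fb.
rewrite -/la -/d in d0 rl.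
have dE : d = ref_level_sum ty n c by apply: ref_count_core_of.
have dE' : ref_count ty mu = ref_level_sum ty n c' by apply: ref_count_core_of.
have one : ~~ two_box ty n r -> recorded ty n d r la mu = [:: (d, row_len la d)].
  by rewrite /two_box /recorded; do 2! case: (_ && _).
have := peel_next hn hp; rewrite -/c'; case.
- case; case: (boolP (two_box ty n r)) => tb pk fb' eq_d two.
    have [_ rl'] := first_bead_row n0 hc' fb'.
    rewrite -/mu dE' eq_d -dE in rl'.
    have e1 : row_len la d = (d + p - 2).+2 by rewrite rl; lia.
    have e2 : row_len mu d = (d + p - 2)%N by rewrite rl'; lia.
    have rm := removed_boxes2 e1 e2.
    have := two isT; rewrite /recorded rm /diag.
    have [rn|rn] := eqVneq r n => /=.
      have r0 : (r == 0%N) = false by lia.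
      rewrite r0 orbF => /andP[hpn us]; rewrite us /=.
      have [pn|pn] := eqVneq p n.
        exists (d + p - 2).+1; split; first by do ? case: ifP => //; lia.
          by rewrite e1.
        by right; rewrite dE' eq_d -dE e2.
      exists (d + p - 2).+2; split; first by do ? case: ifP => //; lia.
        by rewrite e1.
      by right; rewrite dE' eq_d -dE e2.
    move=> /andP[r0 pn]; rewrite andbF r0 andbT.
    have us : uses_s0D ty by move: tb; rewrite /two_box (negPf rn) andbF /= => /andP[].
    rewrite us.
    exists (d + p - 2).+1; split; first by do ? case: ifP => //; lia.
      by rewrite e1.
    by right; rewrite dE' eq_d -dE e2.
  have [_ rl'] := first_bead_row n0 hc' fb'.
  rewrite -/mu dE' eq_d -dE in rl'.
  exists (row_len la d); split=> //; first exact: one.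
  by right; rewrite dE' eq_d -dE rl rl'; split=> //; lia.
- case=> tb e; exists (row_len la d); split=> //; first exact: one.
  by left; rewrite dE' dE e.
case=> us r0 p1 e c1.
have le : (ref_count ty mu < d)%N by rewrite dE' dE e.
have rn : (r == n) = false by lia.
have rlm : row_len mu d = d.-1.
  have b1 : pbead n c' (- 1).
    have := @pbead_opp n c' 0%N%:Z n0; rewrite subr0 => ->.
    by rewrite pbead_lt // -ltNge; lia.
  have hK : (2 <= k * (2 * n))%N by case: hc => k2 _; nia.
  have [h1 h2] := @row_len_bead n c' (k * (2 * n)) (- 1) n0 ltac:(lia) b1.
  have s1 := @nbeads_S n c' (k * (2 * n)) (- 1) ltac:(lia).
  have s2 := @nbeads_S n c' (k * (2 * n)) 0 ltac:(lia).
  have b0 : pbead n c' 0 = false by rewrite (@pbead_lt n c' 0) //; lia.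
  have rc := @ref_count_nbeads n ty c' (k * (2 * n)) n0.
  rewrite -/(core_of n k c') -/mu /reference_diag us dE' in rc.
  rewrite b1 b0 in s1 s2.
  have e0 : - 1 + 1 = 0 :> int by [].
  have e0' : 0 + 1 = 1%N%:Z :> int by [].
  rewrite e0 in s1; rewrite e0' in s2.
  have nd : nbeads n c' (k * (2 * n)) (- 1) = d by rewrite s1 s2 -rc dE e.
  by rewrite nd -[rows_of _]/mu in h2; lia.
have e1 : row_len la d = (d.-1).+2 by rewrite rl p1; lia.
exists (d.-1).+2; split; [|by rewrite e1|by left].
rewrite /recorded rn andbF us r0 eqxx /= (removed_boxes2 e1 rlm) /diag /=.
by do ? case: ifP => //; lia.
Qed.

Lemma peeling_residue_core_of ty n k c p r (la := core_of n k c)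
    (d := ref_count ty la) r' :
  (min_rank ty <= n)%N -> (uses_s0D ty -> ~~ odd (level_sum n c)) ->
  peel ty n c p r -> bounded n k c ->
  (0 < d)%N /\ (peeling_residue ty n la (d, row_len la d) r' <-> r' = r).
Proof.
move=> hn par hp hc; have n2 := min_rank2 hn; have n0 : (0 < n)%N by lia.
have [d0 rl] := first_bead_row n0 hc (peel_first_bead n2 hp).
split=> //; refine (@peeling_residueP ty n d p la hn d0 rl c r r' hp _) => us _.
by rewrite /d ref_count_core_of // odd_ref_level_sum // par.
Qed.

(** * The parity conditions *)

Lemma multiple_gt (a m : int) : 0 < m -> - m < a * m -> 0 <= a.
Proof.
move=> m0 h; have [//|a0] := leP 0 a.
have : 0 <= (- a - 1) * m by apply: mulr_ge0; lia.
lia.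
Qed.

Definition crossing_pred (T : nat) (w : int -> int) : pred int :=
  [pred i : int | (i <= T%:Z) && (T.+1%:Z <= w i)].

Lemma even_card_size (P : pred int) (L : seq int) : uniq L -> L =i P ->
  even_card P <-> ~~ odd (size L).
Proof.
move=> uL LP; split=> [[s [us sP os]]|oL]; last by exists L.
rewrite -(perm_size (_ : perm_eq s L)) //; apply: uniq_perm => // x.
by rewrite sP LP.
Qed.

Definition crossing_level (n T : nat) (w : int -> int) (j : nat) : int :=
  ((w j%:Z + T%:Z) %/ (period n)%:Z)%Z.

Lemma injective_nonmultiple n w (j : nat) (q : int) : quasi n w -> injective w ->
  (0 < j <= 2 * n)%N -> w j%:Z <> q * (period n)%:Z.
Proof.
move=> hw wi hj wj; have : w j%:Z = w (q * (period n)%:Z).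
  by rewrite (quasi_multiple _ hw).
move/wi => e; have q0 : q = 0 by apply: small_multiple e _; rewrite /period; lia.
by rewrite q0 in e; lia.
Qed.

(* The crossings of T are the j - k N or - j - k N, 1 <= j <= n, for suitable
   k, in number `|crossing_level n T w j|. *)
Lemma even_crossing n T w : (T == 0%N) || (T == n) -> quasi n w -> injective w ->
  even_card (crossing_pred T w) <-> ~~ odd (level_sum n (crossing_level n T w)).
Proof.
move=> hT hw wi.
pose z := crossing_level n T w.
pose f (j k : nat) : int := if 0 < z j then j%:Z - (k + (T == 0%N))%N%:Z * (period n)%:Z
  else - j%:Z - k%:Z * (period n)%:Z.
pose L := [seq f j k | j <- iota 1 n, k <- iota 0 `|z j|%N].
have zE j : exists2 s, 0 <= s < (period n)%:Z & w j%:Z = z j * (period n)%:Z + s - T%:Z.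
  exists ((w j%:Z + T%:Z) %% (period n)%:Z)%Z; first by rewrite modz_ge0 // ltz_pmod.
  by rewrite /z /crossing_level -divz_eq; lia.
have sz : size L = level_sum n z.
  rewrite /L size_allpairs_dep /level_sum sumnE big_map /index_iota subn1 /=.
  by apply: eq_bigr => j _; rewrite size_iota.
have Pp : (0 < (period n)%:Z)%R by [].
have wm (q : int) := quasi_multiple q hw.
have nm (j : nat) (q : int) : (0 < j <= n)%N -> w j%:Z <> q * (period n)%:Z.
  by move=> hj; apply: injective_nonmultiple => //; lia.
rewrite -/z -sz; apply: even_card_size.
  apply: allpairs_uniq_dep; rewrite ?iota_uniq //.
    by move=> x _; apply: iota_uniq.
  move=> [j k] [j' k'] /allpairsPdep [x [y [hx hy [-> ->]]]] /allpairsPdep [x' [y' [hx' hy' [-> ->]]]] /=.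
  rewrite /f; move: hx hx'; rewrite !mem_iota => hx hx' e.
  have [k1 [k2 [e1 e2]]] : exists k1 k2 : int,
      (if 0 < z x then x%:Z else - x%:Z) - (if 0 < z x' then x'%:Z else - x'%:Z) = k1 * (period n)%:Z /\
      k1 = k2 /\ k2 = (y + (0 < z x)%R * (T == 0%N))%N%:Z - (y' + (0 < z x')%R * (T == 0%N))%N%:Z.
    eexists; eexists; split; last by split; [reflexivity | reflexivity].
    by move: e; do 2! case: ifP => _; rewrite ?mul1n ?mul0n ?addn0; lia.
  case: e2 => e2 e3; have k0 : k1 = 0.
    by apply: small_multiple e1 _; rewrite /period; do 2! case: ifP => _; lia.
  rewrite k0 mul0r in e1; have xx : x = x' by move: e1; do 2! case: ifP => _; lia.
  by subst x'; have -> : y = y' by lia.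
move=> i; apply/allpairsPdep/idP => [[j [k [hj hk ->]]]|].
  rewrite !mem_iota in hj hk; have [s hs wj] := zE j.
  have hj' : (0 < j <= n)%N by lia.
  rewrite inE /= /f; case: ifP => zj.
    have -> : j%:Z - (k + (T == 0%N))%N%:Z * (period n)%:Z = j%:Z + (- (k + (T == 0%N))%N%:Z) * (period n)%:Z by lia.
    rewrite (quasi_shift _ _ hw) wj.
    case/orP: hT => /eqP eT; rewrite eT /=.
      have s0 : s != 0 by apply/eqP => s0; apply: (nm j (z j)) => //; rewrite wj s0 eT; lia.
      have h1 : 0 <= k%:Z * (period n)%:Z by apply: mulr_ge0.
      have h2 : 0 <= (z j - k%:Z - 1) * (period n)%:Z by apply: mulr_ge0; lia.
      by move: h1 h2 hs; rewrite addn1 -addn1 PoszD /period; lia.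
    have h1 : 0 <= (k + (n == 0%N))%N%:Z * (period n)%:Z by apply: mulr_ge0.
    have h2 : 0 <= (z j - (k + (n == 0%N))%N%:Z - 1) * (period n)%:Z by apply: mulr_ge0; lia.
    by move: h1 h2 hs; rewrite /period; lia.
  have -> : - j%:Z - k%:Z * (period n)%:Z = (- k%:Z) * (period n)%:Z - j%:Z by lia.
  rewrite (quasi_mirror _ _ hw) wj.
  have h1 : 0 <= k%:Z * (period n)%:Z by apply: mulr_ge0.
  have h2 : 0 <= (- z j - k%:Z - 1) * (period n)%:Z by apply: mulr_ge0; lia.
  by move: h1 h2 hs; rewrite /period; lia.
rewrite inE /= => /andP[iT wiT].
have [q [iq|[r hr iq]]] := signed_rep n i.
  by move: wiT; rewrite iq wm -iq; lia.
have [s hs wr] := zE r.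
case: iq => iq; move: iT wiT; rewrite iq ?(quasi_shift _ _ hw) ?(quasi_mirror _ _ hw) wr => iT wiT.
  case/orP: hT => /eqP eT; rewrite eT in iT wiT.
    have h1 : 0 <= z r + q by apply: (multiple_gt Pp); lia.
    have h2 : 0 <= - q - 1 by apply: (multiple_gt Pp); lia.
    exists r, `|- q - 1|%N; rewrite !mem_iota; split; [lia | lia |].
    rewrite /f ifT; last by lia.
    by rewrite eT addn1 /=; have -> : `|- q - 1|%N.+1%:Z = - q by [lia]; lia.
  have h1 : 0 <= z r + q - 1 by apply: (multiple_gt Pp); move: wiT hs; rewrite /period; lia.
  have h2 : 0 <= - q by apply: (multiple_gt Pp); move: iT; rewrite /period; lia.
  exists r, `|q|%N; rewrite !mem_iota; split; [lia | lia |].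
  rewrite /f ifT; last by lia.
  have -> : (T == 0%N) = false by lia.
  by rewrite addn0; have -> : `|q|%N%:Z = - q by [lia]; lia.
have h1 : 0 <= q - z r - 1 by apply: (multiple_gt Pp); move: wiT hs; rewrite /period; lia.
have h2 : 0 <= - q by apply: (multiple_gt Pp); case/orP: hT => /eqP eT; move: iT; rewrite eT /period; lia.
exists r, `|q|%N; rewrite !mem_iota; split; [lia | lia |].
rewrite /f ifF; last by lia.
by have -> : `|q|%N%:Z = - q by [lia]; lia.
Qed.

Lemma even_card_map (P Q : pred int) (h : int -> int) : injective h ->
  (forall x, x \in Q -> exists2 i, i \in P & x = h i) ->
  (forall i, i \in P -> h i \in Q) -> even_card P -> even_card Q.
Proof.
move=> hi h1 h2 [s [us sP os]]; exists [seq h i | i <- s].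
rewrite size_map map_inj_uniq //; split=> // x; apply/mapP/idP => [[i]|/h1 [i iP ->]].
  by rewrite sP => /h2 hQ ->.
by exists i; rewrite ?sP.
Qed.

Lemma even_card_inv0 n w g : quasi n w -> cancel w g -> cancel g w ->
  even_card (crossing_pred 0 w) -> even_card (crossing_pred 0 g).
Proof.
move=> hw wg gw; have hg := inv_quasi hw wg gw.
apply: (even_card_map (h := fun i => - w i)).
- by move=> x y /oppr_inj /(can_inj wg).
- move=> x; rewrite !inE => /andP[x0 gx]; exists (g (- x)); last by rewrite gw opprK.
  case: (hg) => _ ->; rewrite inE; case: (hw) => _ ->; rewrite gw.
  have : x != 0 by apply/eqP => e; move: gx; rewrite e (quasi0 hg).
  lia.
- move=> i; rewrite !inE => /andP[i0 wi]; case: (hg) => _ ->; rewrite wg.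
  have : i != 0 by apply/eqP => e; move: wi; rewrite e (quasi0 hw).
  lia.
Qed.

Lemma even_card_invn n w g : quasi n w -> cancel w g -> cancel g w ->
  even_card (crossing_pred n w) -> even_card (crossing_pred n g).
Proof.
move=> hw wg gw; have hg := inv_quasi hw wg gw.
apply: (even_card_map (h := fun i => 1 * (period n)%:Z - w i)).
- by move=> x y e; apply: (can_inj wg); lia.
- move=> x; rewrite !inE => /andP[x0 gx].
  exists (g (1 * (period n)%:Z - x)); last by rewrite gw; lia.
  rewrite inE gw (quasi_mirror _ _ hg); move: x0 gx; rewrite /period; lia.
- move=> i; rewrite !inE => /andP[i0 wi]; rewrite (quasi_mirror _ _ hg) wg.
  by move: i0 wi; rewrite /period; lia.
Qed.

Lemma mirrored_inv n w : mirrored n w -> exists g, cancel w g /\ cancel g w.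
Proof. by case=> [[g wg gw] _ _]; exists g. Qed.

Lemma mirrored_inj n w : mirrored n w -> injective w.
Proof. by case=> /bij_inj. Qed.

Lemma eq_level_sum n c c' : (forall i : nat, (0 < i <= n)%N -> `|c i|%N = `|c' i|%N) ->
  level_sum n c = level_sum n c'.
Proof. by move=> h; apply: eq_big_nat => i hi; apply: h; lia. Qed.

Lemma even_crossing0 n w c : mirrored n w -> levels n w c ->
  even_card (crossing_pred 0 w) <-> ~~ odd (level_sum n c).
Proof.
move=> mw hc; have [g [wg gw]] := mirrored_inv mw.
have hw := mirrored_quasi mw; have hg := inv_quasi hw wg gw.
have wi := mirrored_inj mw.
have -> : level_sum n c = level_sum n (crossing_level n 0 g).
  apply: eq_level_sum => i hi.
  rewrite (levels_uniq hw wi hc (levels_inv hw wg gw) hi) /crossing_level addr0.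
  lia.
rewrite -even_crossing //; last exact: can_inj gw.
by split; apply: even_card_inv0; eauto.
Qed.

Lemma even_crossingn n w : mirrored n w ->
  even_card (crossing_pred n w) <-> ~~ odd (level_sum n (crossing_level n n w)).
Proof.
move=> mw; apply: even_crossing; rewrite ?eqxx ?orbT //.
  exact: mirrored_quasi.
exact: mirrored_inj mw.
Qed.

Lemma divz_oppD (n : nat) (y : int) :
  ((- y + n%:Z) %/ (period n)%:Z)%Z = - ((y + n%:Z) %/ (period n)%:Z)%Z.
Proof.
have E := divz_eq (y + n%:Z) (period n)%:Z.
have h0 := @modz_ge0 (y + n%:Z) (period n)%:Z isT.
have h1 : ((y + n%:Z) %% (period n)%:Z)%Z < (period n)%:Z by apply: ltz_pmod.
move: (_ %/ _)%Z (_ %% _)%Z E h0 h1 => q s E h0 h1.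
have -> : - y + n%:Z = (- q) * (period n)%:Z + ((2 * n)%N%:Z - s).
  by move: E; rewrite /period; lia.
by have [-> _] := @divz_period n (- q) ((2 * n)%N%:Z - s) ltac:(move: h1; rewrite /period; lia).
Qed.

Lemma crossing_level_gen ty n (r : 'I_n.+1) w (j : nat) : quasi n w -> (2 <= n)%N ->
  (0 < j <= n)%N -> crossing_level n n (w \o gen ty r) j =
  if (r == 0 :> nat)%N then
    if uses_s0D ty then
      if (j == 1)%N then - crossing_level n n w 2
      else if (j == 2)%N then - crossing_level n n w 1
      else crossing_level n n w j
    else if (j == 1)%N then - crossing_level n n w 1 else crossing_level n n w j
  else if (r == n :> nat)%N then
    if uses_snD ty then
      if (j == n.-1)%N then 1 - crossing_level n n w n
      else if (j == n)%N then 1 - crossing_level n n w n.-1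
      else crossing_level n n w j
    else if (j == n)%N then 1 - crossing_level n n w n else crossing_level n n w j
  else if (j == r)%N then crossing_level n n w r.+1
  else if (j == r.+1)%N then crossing_level n n w r else crossing_level n n w j.
Proof.
move=> hw n2 hj; have hr := ltn_ord r.
have N (i : nat) (x : int) : x = - i%:Z ->
    ((w x + n%:Z) %/ (period n)%:Z)%Z = - crossing_level n n w i.
  by move=> ->; case: (hw) => _ ->; rewrite divz_oppD.
have M (i : nat) (x : int) : x = 1 * (period n)%:Z - i%:Z ->
    ((w x + n%:Z) %/ (period n)%:Z)%Z = 1 - crossing_level n n w i.
  move=> ->; rewrite (quasi_mirror _ _ hw).
  have -> : 1 * (period n)%:Z - w i%:Z + n%:Z = 1 * (period n)%:Z + (- w i%:Z + n%:Z) by lia.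
  by rewrite divzMDl // divz_oppD.
rewrite {1}/crossing_level /= gen_small // /gen_image.
have [r0|r0] := eqVneq (r : nat) 0%N.
  case: (uses_s0D ty).
    case: eqP => [_|_]; first by apply: (N 2%N); lia.
    by case: eqP => [_|_] //; apply: (N 1%N); lia.
  by case: eqP => [_|_] //; apply: (N 1%N); lia.
have [rn|rn] := eqVneq (r : nat) n.
  case: (uses_snD ty).
    case: eqP => [_|_]; first by apply: (M n); rewrite /period; lia.
    by case: eqP => [_|_] //; apply: (M n.-1); rewrite /period; lia.
  by case: eqP => [_|_] //; apply: (M n); rewrite /period; lia.
by case: eqP => [_|_] //; case: eqP => [_|_].
Qed.

Lemma odd_crossing_gen ty n (r : 'I_n.+1) w : quasi n w -> (2 <= n)%N ->
  odd (level_sum n (crossing_level n n (w \o gen ty r))) =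
  odd (level_sum n (crossing_level n n w)) (+) ((r == n :> nat) && ~~ uses_snD ty).
Proof.
move=> hw n2; have hr := ltn_ord r; have e : n.-1.+1 = n by lia.
pose i := if (r == 0 :> nat)%N then 1%N else if (r == n :> nat)%N then n.-1 else r : nat.
have hi : (0 < i < n)%N by rewrite /i; do ? case: eqP; lia.
pose c' a := if (0 < a <= n)%N then crossing_level n n (w \o gen ty r) a else crossing_level n n w a.
have -> : level_sum n (crossing_level n n (w \o gen ty r)) = level_sum n c'.
  by apply: eq_level_sum => a ha; rewrite /c' ha.
have Hc a : a != i -> a != i.+1 -> c' a = crossing_level n n w a.
  move=> a1 a2; rewrite /c'; case: ifP => // ha; rewrite crossing_level_gen //.
  by move: a1 a2; rewrite /i; do ? case: ifP => //=; lia.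
have H := level_sum_pair hi Hc.
have c1 : c' i = crossing_level n n (w \o gen ty r) i by rewrite /c' ifT //; lia.
have c2 : c' i.+1 = crossing_level n n (w \o gen ty r) i.+1 by rewrite /c' ifT //; lia.
rewrite c1 c2 !crossing_level_gen // {Hc c1 c2} in H; try lia.
move: H; rewrite /i; have [r0|r0] := eqVneq (r : nat) 0%N.
  have -> : (r == n :> nat) = false by lia.
  rewrite addbF; case: (uses_s0D ty) => /=; lia.
have [rn|rn] := eqVneq (r : nat) n.
  rewrite !e !eqxx; have -> : (n == n.-1) = false by lia.
  have -> : (n.-1 == n) = false by lia.
  case: (uses_snD ty) => /=; lia.
by rewrite /= !eqxx; have -> : (r.+1 == r) = false by [lia]; lia.
Qed.

(** * Words and sorted elements *)

Lemma gen_bij ty n (r : 'I_n.+1) : (2 <= n)%N -> bijective (gen ty r).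
Proof. by move=> n2; exists (gen ty r); apply: genK. Qed.

Lemma mirrored_comp n u v : mirrored n u -> mirrored n v -> mirrored n (u \o v).
Proof.
move=> [u1 u2 u3] [v1 v2 v3]; split=> [|i|i] /=; last 2 first.
- by rewrite v2 u2.
- by rewrite v3 u3.
exact: bij_comp.
Qed.

Lemma gen_mirrored ty n (r : 'I_n.+1) : (2 <= n)%N -> mirrored n (gen ty r).
Proof. by move=> n2; have [h1 h2] := gen_quasi ty r; split=> //; apply: gen_bij. Qed.

Lemma mirrored_id n : mirrored n id.
Proof. by split=> //; exists id. Qed.

Lemma mirrored_levels n w : mirrored n w -> exists c, levels n w c.
Proof.
move=> mw; have [g [wg gw]] := mirrored_inv mw.
by eexists; apply: levels_inv (mirrored_quasi mw) wg gw.
Qed.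

Lemma affine_parity ty n w c : affine_group ty n w -> levels n w c ->
  uses_s0D ty -> ~~ odd (level_sum n c).
Proof. by move=> [mw h _] hc us; apply/(even_crossing0 mw hc)/h. Qed.

Lemma affine_id ty n : affine_group ty n id.
Proof.
split=> [||_]; first exact: mirrored_id.
  by move=> _; exists [::]; split=> // x; rewrite !inE /=; apply/esym/negbTE; lia.
by exists [::]; split=> // x; rewrite !inE /=; apply/esym/negbTE; lia.
Qed.

Lemma affine_gen_left ty n (r : 'I_n.+1) w : (2 <= n)%N ->
  affine_group ty n w -> affine_group ty n (gen ty r \o w).
Proof.
move=> n2 aw; have [mw h0 hn] := aw; have hw := mirrored_quasi mw.
have mg := mirrored_comp (gen_mirrored ty r n2) mw.
have [c hc] := mirrored_levels mw.
split=> // us.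
  apply/(even_crossing0 mg (levels_gen ty r n2 hw hc)).
  rewrite level_sum_act_odd //; last by rewrite -ltnS.
  exact: affine_parity aw hc us.
have [g [wg gw]] := mirrored_inv mw.
have hg := inv_quasi hw wg gw.
have m_g : mirrored n g by case: (hg) => g1 g2; split=> //; exists w.
have m_gg := mirrored_comp m_g (gen_mirrored ty r n2).
apply: (even_card_invn (w := g \o gen ty r) (mirrored_quasi m_gg)).
- by move=> x /=; rewrite gw genK.
- by move=> x /=; rewrite genK // wg.
apply/(even_crossingn m_gg); rewrite odd_crossing_gen // us andbF addbF.
by apply/(even_crossingn m_g)/(even_card_invn hw wg gw)/hn.
Qed.

Lemma affine_gen_right ty n (r : 'I_n.+1) w : (2 <= n)%N -> (0 < r)%N ->
  affine_group ty n w -> affine_group ty n (w \o gen ty r).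
Proof.
move=> n2 r0 aw; have [mw h0 hn] := aw; have hw := mirrored_quasi mw.
have mg := mirrored_comp mw (gen_mirrored ty r n2).
have [c hc] := mirrored_levels mw.
split=> // us.
  apply/(even_crossing0 mg (levels_right hc (gen_window ty n2 r0))).
  exact: affine_parity aw hc us.
apply/(even_crossingn mg); rewrite odd_crossing_gen // us andbF addbF.
exact/(even_crossingn mw)/hn.
Qed.

Lemma word_affine ty n (rs : seq 'I_n.+1) : (2 <= n)%N ->
  affine_group ty n (word_prod ty rs).
Proof.
move=> n2; elim: rs => [|r rs IH]; first exact: affine_id.
exact: affine_gen_left.
Qed.

Lemma word_prod_cat ty n (rs ts : seq 'I_n.+1) :
  word_prod ty (rs ++ ts) =1 word_prod ty rs \o word_prod ty ts.
Proof. by elim: rs => [|r rs IH] x //=; rewrite IH. Qed.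

Lemma word_prod_rev ty n (rs : seq 'I_n.+1) : (2 <= n)%N ->
  cancel (word_prod ty (rev rs)) (word_prod ty rs).
Proof.
move=> n2; elim: rs => [|r rs IH] x //=.
rewrite rev_cons -cats1 word_prod_cat /= IH.
exact: genK.
Qed.

Lemma word_window ty n (rs : seq 'I_n.+1) : (2 <= n)%N ->
  all (fun r : 'I_n.+1 => (0 < r)%N) rs -> window_perm n (word_prod ty rs).
Proof.
move=> n2; elim: rs => [_|r rs IH /= /andP[r0 /IH hrs]]; first by move=> j hj; exists j.
exact: window_perm_comp (gen_window ty n2 r0) hrs.
Qed.

Lemma parabolic_window ty n x : (2 <= n)%N -> parabolic_group ty n x -> window_perm n x.
Proof.
move=> n2 [rs all_rs e] j hj; have [k hk xk] := word_window ty n2 all_rs hj.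
by exists k; rewrite // -e.
Qed.

Definition sorted_window ty n (w : int -> int) : bool :=
  all (fun i : nat => w i%:Z < w i.+1%:Z) (iota 1 n.-1) &&
  (if uses_snD ty then w n.-1%:Z < w n.+1%:Z else w n%:Z < w n.+1%:Z).

Lemma block_lt (m m' s s' P lo : int) : 0 < P -> lo <= s < lo + P -> lo <= s' < lo + P ->
  s + m * P < s' + m' * P -> m < m' \/ m = m' /\ s < s'.
Proof.
move=> P0 h h' lt; have [mm|mm|mm] := ltgtP m m'; first by left.
  have : 0 <= (m - m' - 1) * P by apply: mulr_ge0; lia.
  lia.
by right; split=> //; move: lt; rewrite mm; lia.
Qed.

Lemma period_block (n : nat) (lo x : int) : exists m s : int,
  lo <= s < lo + (period n)%:Z /\ x = s + m * (period n)%:Z.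
Proof.
have E := divz_eq (x - lo) (period n)%:Z.
have h0 := @modz_ge0 (x - lo) (period n)%:Z isT.
have h1 : ((x - lo) %% (period n)%:Z)%Z < (period n)%:Z by apply: ltz_pmod.
exists ((x - lo) %/ (period n)%:Z)%Z, (lo + ((x - lo) %% (period n)%:Z)%Z); lia.
Qed.

(* The generator g permutes each block lo + m N <= x < lo + (m + 1) N, so it can
   only reverse the order of two elements of the same block. *)
Lemma gen_flip n g (lo x y : int) : quasi n g ->
  (forall s, lo <= s < lo + (period n)%:Z -> lo <= g s < lo + (period n)%:Z) ->
  x < y -> g y <= g x -> exists m s s' : int,
  [/\ x = s + m * (period n)%:Z, y = s' + m * (period n)%:Z,
      lo <= s < lo + (period n)%:Z, lo <= s' < lo + (period n)%:Z & s < s' /\ g s' <= g s].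
Proof.
move=> hg hb xy gyx.
have [m [s [hs ex]]] := period_block n lo x.
have [m' [s' [hs' ey]]] := period_block n lo y.
have gx := quasi_shift m s hg; have gy := quasi_shift m' s' hg.
rewrite -ex in gx; rewrite -ey in gy.
have P0 : 0 < (period n)%:Z by [].
rewrite ex ey in xy; have [mm|[mm ss]] := block_lt P0 hs hs' xy.
  have : 0 <= (m' - m - 1) * (period n)%:Z by apply: mulr_ge0; lia.
  by have := hb s hs; have := hb s' hs'; lia.
exists m, s, s'; split=> //; first by rewrite mm.
by split=> //; move: gyx; rewrite gx gy mm; lia.
Qed.

Lemma level_at n w c (i j : nat) (q : int) : quasi n w -> injective w -> levels n w c ->
  (0 < i <= n)%N -> (0 < j <= 2 * n)%N ->
  w j%:Z = i%:Z + q * (period n)%:Z -> c i = q.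
Proof.
move=> hw wi hc hi hj wj; have [k hk wk] := hc i hi.
have : w j%:Z = w (k%:Z + (q - c i) * (period n)%:Z).
  by rewrite (quasi_shift _ _ hw) wj wk; lia.
move/wi => e; suff : q - c i = 0 by lia.
by apply: (@small_multiple (j%:Z - k%:Z) _ (period n)%:Z); [lia | rewrite /period; lia].
Qed.

Lemma level_at_mirror n w c (i j : nat) (q : int) : quasi n w -> injective w ->
  levels n w c -> (0 < i <= n)%N -> (0 < j <= 2 * n)%N ->
  w j%:Z = q * (period n)%:Z - i%:Z -> c i = 1 - q.
Proof.
move=> hw wi hc hi hj wj; apply: (level_at (j := (period n - j)%N) hw wi hc hi).
  by rewrite /period; lia.
have -> : (period n - j)%N%:Z = 1 * (period n)%:Z - j%:Z by rewrite /period; lia.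
by rewrite (quasi_mirror _ _ hw) wj; lia.
Qed.

Lemma gen_pos_block ty n (r : 'I_n.+1) s : (2 <= n)%N -> (0 < r)%N ->
  0 <= s < (period n)%:Z -> gen ty r s =
  if s == 0 then 0 else if s <= n%:Z then gen_image ty n r `|s|%N
  else (period n)%:Z - gen_image ty n r `|(period n)%:Z - s|%N.
Proof.
move=> n2 r0 hs; case: eqP => [->|s0]; first exact: quasi0 (gen_quasi ty r).
case: ifP => sn.
  by rewrite -gen_small; last lia; congr (gen _ _ _); lia.
rewrite -gen_mirror; last by move: hs; rewrite /period; lia.
by congr (gen _ _ _); lia.
Qed.

Lemma gen0_block ty n (r : 'I_n.+1) s : (2 <= n)%N -> r = 0%N :> nat ->
  - n%:Z <= s < - n%:Z + (period n)%:Z -> gen ty r s =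
  if s == 0 then 0 else if 0 <= s then gen_image ty n r `|s|%N
  else - gen_image ty n r `|s|%N.
Proof.
move=> n2 r0 hs; case: eqP => [->|s0]; first exact: quasi0 (gen_quasi ty r).
case: ifP => sn.
  by rewrite -gen_small; last (move: hs; rewrite /period; lia); congr (gen _ _ _); lia.
rewrite -gen_neg; last by move: hs; rewrite /period; lia.
by congr (gen _ _ _); lia.
Qed.

Lemma gen_window_lt ty n (r : 'I_n.+1) w c (j k : nat) : (2 <= n)%N ->
  quasi n w -> injective w -> levels n w c ->
  (0 < j <= 2 * n)%N -> (0 < k <= 2 * n)%N ->
  (uses_snD ty -> (j + k)%N != period n) ->
  0 < inv_step ty n r c -> w j%:Z < w k%:Z -> gen ty r (w j%:Z) < gen ty r (w k%:Z).
Proof.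
move=> n2 hw wi hc hj hk jk step lt; have hr := ltn_ord r.
have jkN : uses_snD ty -> w j%:Z + w k%:Z <> (period n)%:Z.
  move=> us e; have /wi e' : w k%:Z = w (1 * (period n)%:Z - j%:Z).
    by rewrite (quasi_mirror _ _ hw); lia.
  by move/eqP: (jk us); apply; lia.
rewrite ltNge; apply/negP => flip.
have L (i : nat) q := @level_at n w c i j q hw wi hc ^~ hj.
have L' (i : nat) q := @level_at n w c i k q hw wi hc ^~ hk.
have M (i : nat) q := @level_at_mirror n w c i j q hw wi hc ^~ hj.
have M' (i : nat) q := @level_at_mirror n w c i k q hw wi hc ^~ hk.
have Z := injective_nonmultiple (q := _) hw wi hj.
have Z' := injective_nonmultiple (q := _) hw wi hk.
move: step; rewrite /inv_step.
have [r0|r0] := eqVneq (r : nat) 0%N.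
  have [m [s [s' [ej ek hs hs' [ss gs]]]]] : exists m s s' : int,
    [/\ w j%:Z = s + m * (period n)%:Z, w k%:Z = s' + m * (period n)%:Z,
      - n%:Z <= s < - n%:Z + (period n)%:Z, - n%:Z <= s' < - n%:Z + (period n)%:Z
      & s < s' /\ gen ty r s' <= gen ty r s].
    apply: (gen_flip (gen_quasi ty r)) lt flip => s hs.
    rewrite gen0_block // /gen_image r0 /=; move: hs; rewrite /period.
    by case: (uses_s0D ty); do ? case: ifP => ?; lia.
  have s0 : s <> 0 by move=> s0; apply: (Z m); rewrite ej s0 add0r.
  have s0' : s' <> 0 by move=> s0'; apply: (Z' m); rewrite ek s0' add0r.
  move: gs; rewrite !gen0_block // /gen_image r0 /=.
  case: (uses_s0D ty) => gs.
    have [[e1 e2]|[e1 e2]] : (s = -2 /\ (s' = 1 \/ s' = 2)) \/ (s = -1 /\ (s' = 1 \/ s' = 2)).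
      by move: gs; do ? case: ifP => ?; lia.
    - have := M 2%N m ltac:(lia); rewrite ej e1 => /(_ ltac:(lia)) => c2.
      case: e2 => e2.
        by have := L' 1%N m ltac:(lia); rewrite ek e2 => /(_ ltac:(lia)); lia.
      by have := L' 2%N m ltac:(lia); rewrite ek e2 => /(_ ltac:(lia)); lia.
    - have := M 1%N m ltac:(lia); rewrite ej e1 => /(_ ltac:(lia)) => c2.
      case: e2 => e2.
        by have := L' 1%N m ltac:(lia); rewrite ek e2 => /(_ ltac:(lia)); lia.
      by have := L' 2%N m ltac:(lia); rewrite ek e2 => /(_ ltac:(lia)); lia.
  have [e1 e2] : s = -1 /\ s' = 1 by move: gs; do ? case: ifP => ?; lia.
  have := M 1%N m ltac:(lia); rewrite ej e1 => /(_ ltac:(lia)) => c2.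
  by have := L' 1%N m ltac:(lia); rewrite ek e2 => /(_ ltac:(lia)); lia.
have [m [s [s' [ej ek hs hs' [ss gs]]]]] : exists m s s' : int,
    [/\ w j%:Z = s + m * (period n)%:Z, w k%:Z = s' + m * (period n)%:Z,
      0 <= s < 0 + (period n)%:Z, 0 <= s' < 0 + (period n)%:Z
      & s < s' /\ gen ty r s' <= gen ty r s].
  apply: (gen_flip (gen_quasi ty r)) lt flip => s hs.
  rewrite gen_pos_block //; try lia.
  rewrite /gen_image (negPf r0); move: hs; rewrite /period.
  by case: (uses_snD ty); do ? case: ifP => ?; lia.
have s0 : s <> 0 by move=> s0; apply: (Z m); rewrite ej s0 add0r.
have s0' : s' <> 0 by move=> s0'; apply: (Z' m); rewrite ek s0' add0r.
move: gs; rewrite !gen_pos_block; try lia.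
rewrite /gen_image (negPf r0).
have [rn|rn] := eqVneq (r : nat) n.
  case: (boolP (uses_snD ty)) => us gs.
    have [[e1 e2]|[e1 e2]] : (s = n.-1%:Z /\ (s' = n.+1%:Z \/ s' = n.+2%:Z))
      \/ (s = n%:Z /\ (s' = n.+1%:Z \/ s' = n.+2%:Z)).
      by move: gs hs hs'; rewrite /period; do ? case: ifP => ?; lia.
    - have := L n.-1 m ltac:(lia); rewrite ej e1 => /(_ ltac:(lia)) => c2.
      case: e2 => e2.
        have := M' n (m + 1) ltac:(lia); rewrite ek e2.
        by move=> /(_ ltac:(rewrite /period; lia)); lia.
      have := M' n.-1 (m + 1) ltac:(lia); rewrite ek e2.
      move=> /(_ ltac:(rewrite /period; lia)) => c3.
      have m0 : m = 0 by lia.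
      by have := jkN us; rewrite ej ek e1 e2 m0 /period; lia.
    - have := L n m ltac:(lia); rewrite ej e1 => /(_ ltac:(lia)) => c2.
      case: e2 => e2.
        have := M' n (m + 1) ltac:(lia); rewrite ek e2.
        move=> /(_ ltac:(rewrite /period; lia)) => c3.
        have m0 : m = 0 by lia.
        by have := jkN us; rewrite ej ek e1 e2 m0 /period; lia.
      have := M' n.-1 (m + 1) ltac:(lia); rewrite ek e2.
      by move=> /(_ ltac:(rewrite /period; lia)); lia.
  have [e1 e2] : s = n%:Z /\ s' = n.+1%:Z.
    by move: gs hs hs'; rewrite /period; do ? case: ifP => ?; lia.
  have := L n m ltac:(lia); rewrite ej e1 => /(_ ltac:(lia)) => c2.
  have := M' n (m + 1) ltac:(lia); rewrite ek e2.
  by move=> /(_ ltac:(rewrite /period; lia)); lia.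
move=> gs.
have [[e1 e2]|[e1 e2]] : (s = (r : nat)%:Z /\ s' = r.+1%:Z) \/
    (s = (period n)%:Z - r.+1%:Z /\ s' = (period n)%:Z - (r : nat)%:Z).
  by move: gs hs hs'; rewrite /period; do ? case: ifP => ?; lia.
  have := L r m ltac:(lia); rewrite ej e1 => /(_ erefl) => c2.
  by have := L' r.+1 m ltac:(lia); rewrite ek e2 => /(_ erefl); lia.
have := M r.+1 (m + 1) ltac:(lia); rewrite ej e1 => /(_ ltac:(lia)) => c2.
by have := M' r (m + 1) ltac:(lia); rewrite ek e2 => /(_ ltac:(lia)); lia.
Qed.

Lemma sorted_window_gen ty n (r : 'I_n.+1) w c : (2 <= n)%N ->
  quasi n w -> injective w -> levels n w c -> 0 < inv_step ty n r c ->
  sorted_window ty n w -> sorted_window ty n (gen ty r \o w).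
Proof.
move=> n2 hw wi hc step /andP[/allP h1 h2]; apply/andP; split.
  apply/allP => i hi; have hi' := hi; rewrite mem_iota in hi'.
  apply: (gen_window_lt n2 hw wi hc _ _ _ step (h1 i hi)); try lia.
  by rewrite /period; lia.
move: h2; case: ifP => us h2.
  by apply: (gen_window_lt n2 hw wi hc _ _ _ step h2); rewrite /period; lia.
by apply: (gen_window_lt n2 hw wi hc _ _ _ step h2); rewrite ?us /period; lia.
Qed.

Lemma inv_step_le1 ty n r c : inv_step ty n r c <= 1.
Proof. by rewrite /inv_step; do ? case: ifP => _; lia. Qed.

Lemma word_length ty n (rs : seq 'I_n.+1) c : (2 <= n)%N ->
  levels n (word_prod ty rs) c ->
  ninv ty n c <= (size rs)%:Z /\
  ((size rs)%:Z <= ninv ty n c -> sorted_window ty n (word_prod ty rs)).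
Proof.
move=> n2; elim: rs c => [|r rs IH] c hc /=.
  have z := levels_uniq (@quasi_id n) (@inj_id int) hc (@levels_id n).
  rewrite (eq_ninv _ z) ninv0; split=> // _; apply/andP; split; last by case: ifP; lia.
  by apply/allP => i _; lia.
have [mw _ _] := word_affine ty rs n2.
have hw := mirrored_quasi mw; have wi := mirrored_inj mw.
have [c' hc'] := mirrored_levels mw.
have hg := levels_gen ty r n2 hw hc'.
have mg := mirrored_comp (gen_mirrored ty r n2) mw.
rewrite (eq_ninv ty (levels_uniq (mirrored_quasi mg) (mirrored_inj mg) hc hg)).
rewrite ninv_act //; last by rewrite -ltnS.
have [h1 h2] := IH c' hc'; have h3 := inv_step_le1 ty n r c'.
split; first by lia.
move=> h; apply: sorted_window_gen hc' _ _ => //; first by lia.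
by apply: h2; lia.
Qed.

Definition potential (n M : nat) (w : int -> int) : int :=
  \sum_(1 <= j < n.+1) (n.+1%:Z - j%:Z) * (w j%:Z + M%:Z).

Definition window_bounded (n M : nat) (w : int -> int) : Prop :=
  forall j : nat, (0 < j <= 2 * n)%N -> - M%:Z <= w j%:Z.

Lemma potential_ge0 n M w : window_bounded n M w -> 0 <= potential n M w.
Proof.
move=> h; rewrite /potential big_nat_cond; apply: sumr_ge0 => j hj.
by apply: mulr_ge0; [lia | have := h j ltac:(lia); lia].
Qed.

Lemma window_bounded_gen ty n M (r : 'I_n.+1) w : (2 <= n)%N -> (0 < r)%N ->
  window_bounded n M w -> window_bounded n M (w \o gen ty r).
Proof.
move=> n2 r0 h j hj /=; have [k hk e] := gen_window ty n2 r0 hj.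
by rewrite -e genK //; apply: h.
Qed.

Lemma potential_pair n M i u w : (0 < i < n)%N ->
  (forall a : nat, (0 < a <= n)%N -> a != i -> a != i.+1 -> u a%:Z = w a%:Z) ->
  potential n M u - potential n M w =
  (n%:Z - i%:Z) * (u i%:Z + u i.+1%:Z - (w i%:Z + w i.+1%:Z)) + u i%:Z - w i%:Z.
Proof.
move=> hi h; rewrite /potential (@eq_sum_pair n i) //; first by lia.
by move=> a ha a1 a2; rewrite h.
Qed.

Lemma sort_step ty n M w : (2 <= n)%N -> quasi n w -> injective w ->
  ~~ sorted_window ty n w -> exists2 r : 'I_n.+1, (0 < r)%N &
    potential n M (w \o gen ty r) < potential n M w.
Proof.
move=> n2 hw wi; have e : n.-1.+1 = n by lia.
have lt (x y : int) : x != y -> ~~ (w x < w y) -> w y < w x.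
  by move=> xy; rewrite -leNgt le_eqVlt => /orP[/eqP /wi yx|//]; lia.
have mirr (i : nat) (x : int) : x = 1 * (period n)%:Z - i%:Z -> w x = (period n)%:Z - w i%:Z.
  by move=> ->; rewrite (quasi_mirror _ _ hw) mul1r.
rewrite negb_and => /orP[/allPn [i]|].
  rewrite mem_iota => hi /lt h; have {}h := h ltac:(lia).
  have ri : (i < n.+1)%N by lia.
  exists (Ordinal ri) => /=; first by lia.
  have G (a : nat) : (0 < a <= n)%N -> gen ty (Ordinal ri) a%:Z =
      if (a == i)%N then i.+1%:Z else if (a == i.+1)%N then i%:Z else a%:Z.
    move=> ha; rewrite gen_small // /gen_image /=.
    have -> : (i == 0%N) = false by lia.
    by have -> : (i == n) = false by lia.
  have := @potential_pair n M i (w \o gen ty (Ordinal ri)) w ltac:(lia).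
  rewrite /= !G ?eqxx; try lia.
  have -> : (i.+1 == i) = false by lia.
  move=> H; have {}H := H ltac:(by move=> a ha /negPf a1 /negPf a2; rewrite G ?a1 ?a2).
  rewrite [X in (n%:Z - _) * X](_ : _ = 0) ?mulr0 in H; last by lia.
  by lia.
have N0 : (n == 0%N) = false by lia.
case: ifP => us /lt h; have {}h := h ltac:(lia); exists ord_max => //=; try lia.
  have G (a : nat) : (0 < a <= n)%N -> gen ty (@ord_max n) a%:Z =
      if (a == n.-1)%N then n.+1%:Z else if (a == n)%N then n.+2%:Z else a%:Z.
    by move=> ha; rewrite gen_small // /gen_image /= N0 eqxx us.
  have := @potential_pair n M n.-1 (w \o gen ty (@ord_max n)) w ltac:(lia).
  rewrite e /= !G ?eqxx; try lia.
  have -> : (n == n.-1) = false by lia.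
  move=> H; have {}H := H ltac:(by move=> a ha /negPf a1 /negPf a2; rewrite G ?a1 ?a2).
  have m1 := mirr n n.+1%:Z ltac:(rewrite /period; lia).
  have m2 := mirr n.-1 n.+2%:Z ltac:(rewrite /period; lia).
  have n1 : n%:Z - n.-1%:Z = 1 by lia.
  rewrite n1 mul1r in H; lia.
have G (a : nat) : (0 < a <= n)%N -> gen ty (@ord_max n) a%:Z =
    if (a == n)%N then n.+1%:Z else a%:Z.
  by move=> ha; rewrite gen_small // /gen_image /= N0 eqxx us.
have := @potential_pair n M n.-1 (w \o gen ty (@ord_max n)) w ltac:(lia).
rewrite e /= !G ?eqxx; try lia.
have -> : (n.-1 == n) = false by lia.
move=> H; have {}H := H ltac:(by move=> a ha /negPf a1 /negPf a2; rewrite G ?a1 ?a2).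
have n1 : n%:Z - n.-1%:Z = 1 by lia.
rewrite n1 mul1r in H; lia.
Qed.

Lemma sort_exists ty n w : (2 <= n)%N -> affine_group ty n w ->
  exists rs : seq 'I_n.+1, [/\ all (fun r : 'I_n.+1 => (0 < r)%N) rs,
    affine_group ty n (w \o word_prod ty rs) & sorted_window ty n (w \o word_prod ty rs)].
Proof.
move=> n2 aw; pose M := window n w.
have hM : window_bounded n M w.
  move=> j hj; have : (`|w j%:Z| <= M)%N.
    rewrite /M /window; apply: (@leq_bigmax_seq _ _ _ (fun j : nat => `|w j%:Z|%N)) => //.
    by rewrite mem_index_iota; lia.
  by lia.
move: (M) hM => {}M hM.
have [m] := ubnP `|potential n M w|%N.
elim: m w aw hM => // m IH w aw hM hm.
have [mw _ _] := aw.
have [sw|nsw] := boolP (sorted_window ty n w); first by exists [::].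
have [r r0 lt] := sort_step M n2 (mirrored_quasi mw) (mirrored_inj mw) nsw.
have hMr := window_bounded_gen ty n2 r0 hM.
have p1 := potential_ge0 hM; have p2 := potential_ge0 hMr.
have [rs [h1 h2 h3]] := IH _ (affine_gen_right n2 r0 aw) hMr ltac:(lia).
by exists (r :: rs); split=> //=; rewrite r0.
Qed.

Lemma sortedC_lt n w : (0 < n)%N -> quasi n w -> sorted_window CC n w ->
  forall j k : nat, (0 < j)%N -> (j < k)%N -> (k <= 2 * n)%N -> w j%:Z < w k%:Z.
Proof.
move=> n0 hw /andP[/allP h1 h2].
have S (j : nat) : (0 < j < 2 * n)%N -> w j%:Z < w j.+1%:Z.
  move=> hj; have [jn|jn|->//] := ltngtP j n.
    by apply: h1; rewrite mem_iota; lia.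
  have := h1 (2 * n - j)%N; rewrite mem_iota => /(_ ltac:(lia)).
  have e1 : j.+1%:Z = 1 * (period n)%:Z - (2 * n - j)%N%:Z by rewrite /period; lia.
  have e2 : j%:Z = 1 * (period n)%:Z - (2 * n - j).+1%N%:Z by rewrite /period; lia.
  by rewrite e1 e2 !(quasi_mirror _ _ hw); lia.
move=> j k j0; elim: k => // k IH; rewrite ltnS leq_eqVlt => /orP[/eqP <-|jk] hk.
  by apply: S; lia.
by apply: lt_trans (IH jk _) (S k _); lia.
Qed.

Lemma sortedC_unique n u v c : (0 < n)%N -> quasi n u -> quasi n v ->
  injective u -> injective v -> levels n u c -> levels n v c ->
  sorted_window CC n u -> sorted_window CC n v -> u =1 v.
Proof.
move=> n0 hu hv ui vi lu lv su sv.
pose vals (w : int -> int) := [seq w j%:Z | j <- iota 1 (2 * n)].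
have st w : quasi n w -> sorted_window CC n w -> sorted <%R (vals w).
  move=> hw sw; pose P := [pred j : nat | (0 < j <= 2 * n)%N].
  apply: (@homo_sorted_in _ _ P (fun j : nat => w j%:Z) ltn).
  - by move=> j k; rewrite !inE => hj hk jk; apply: (sortedC_lt n0 hw sw _ jk); lia.
  - by apply/allP => j; rewrite mem_iota /=; lia.
  - exact: iota_ltn_sorted.
have sub w w' : quasi n w -> quasi n w' -> injective w -> levels n w c -> levels n w' c ->
    {subset vals w <= vals w'}.
  move=> hw hw' wi lw lw' x /mapP [j]; rewrite mem_iota => hj ->.
  have [q [e|[i hi [e|e]]]] := signed_rep n (w j%:Z).
  - by have := injective_nonmultiple (q := q) hw wi (j := j) ltac:(lia); rewrite e.
  - have cq := level_at hw wi lw hi (j := j) ltac:(lia) e.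
    have [k hk wk] := lw' i hi; apply/mapP; exists k; rewrite ?mem_iota; first by lia.
    by rewrite wk e cq.
  have cq := level_at_mirror hw wi lw hi (j := j) ltac:(lia) e.
  have [k hk wk] := levels_mirror hw' lw' hi; apply/mapP; exists k; rewrite ?mem_iota; first by lia.
  by rewrite wk e cq; lia.
have ev : vals u = vals v.
  apply: (irr_sorted_eq lt_trans ltxx) => [||x]; [exact: st | exact: st |].
  by apply/idP/idP; apply: sub.
have := (eq_in_map _ _ _).2 ev => {}ev.
apply: (quasi_ext hu hv) => k hk.
by apply: ev; rewrite mem_iota; lia.
Qed.

Lemma sorted_unique ty n u v c : (2 <= n)%N -> affine_group ty n u ->
  affine_group ty n v -> levels n u c -> levels n v c ->
  sorted_window ty n u -> sorted_window ty n v -> u =1 v.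
Proof.
move=> n2 [mu _ pu] [mv _ pv] lu lv.
have hu := mirrored_quasi mu; have hv := mirrored_quasi mv.
have ui := mirrored_inj mu; have vi := mirrored_inj mv.
have n0 : (0 < n)%N by lia.
have [us|us] := boolP (uses_snD ty); last first.
  rewrite /sorted_window (negPf us) => su sv.
  exact: (@sortedC_unique n u v c).
pose t := gen CC (@ord_max n).
have N0 : (n == 0%N) = false by lia.
have tE (a : nat) : (0 < a <= n)%N -> t a%:Z = if (a == n)%N then n.+1%:Z else a%:Z.
  by move=> ha; rewrite /t gen_small // /gen_image /= N0 eqxx.
have mt := gen_mirrored CC (@ord_max n) n2.
have tt x : t (t x) = x := genK CC (@ord_max n) n2 x.
have tn1 : t n.+1%:Z = n%:Z by rewrite -[RHS]tt (tE n) ?eqxx ?n0 ?leqnn.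
(* The values in positions n and n + 1 may be exchanged, which the parity
   condition excludes. *)
have norm w : mirrored n w -> levels n w c -> sorted_window ty n w ->
    exists w', [/\ w' = w \/ w' = w \o t, sorted_window CC n w', levels n w' c & mirrored n w'].
  rewrite /sorted_window us => mw lw /andP[h1 h2].
  have wi := mirrored_inj mw.
  have [lt|ge] := boolP (w n%:Z < w n.+1%:Z).
    by exists w; split; [left | rewrite h1 lt | |].
  exists (w \o t); split; [by right | | exact: levels_right (gen_window (r := @ord_max n) CC n2 n0) | exact: mirrored_comp].
  have lt : w n.+1%:Z < w n%:Z.
    by move: ge; rewrite -leNgt le_eqVlt => /orP[/eqP /wi|//]; lia.
  apply/andP; split; last by rewrite /= tn1 tE ?eqxx ?n0 ?leqnn.
  apply/allP => i hi /=; have hi' := hi; rewrite mem_iota in hi'.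
  rewrite !tE; try lia; have -> : (i == n) = false by lia.
  case: eqP => [e|_]; last exact: (allP h1).
  by move: h2; rewrite -e.
have par w : mirrored n w -> (uses_snD ty -> even_card (crossing_pred n w)) ->
    ~~ odd (level_sum n (crossing_level n n w)).
  by move=> mw /(_ us) /(even_crossingn mw).
have parT w : mirrored n w -> odd (level_sum n (crossing_level n n (w \o t))) =
    ~~ odd (level_sum n (crossing_level n n w)).
  by move=> mw; rewrite (odd_crossing_gen CC (@ord_max n) (mirrored_quasi mw) n2) /= eqxx addbT.
have ext w w' : w =1 w' -> level_sum n (crossing_level n n w) = level_sum n (crossing_level n n w').
  by move=> e; apply: eq_level_sum => i _; rewrite /crossing_level e.
have p_u := par u mu pu; have p_v := par v mv pv.
move=> /(norm u mu lu) [u' [du su lu' mu']] /(norm v mv lv) [v' [dv sv lv' mv']].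
have e := sortedC_unique n0 (mirrored_quasi mu') (mirrored_quasi mv') (mirrored_inj mu') (mirrored_inj mv') lu' lv' su sv.
case: du dv => [eu|eu] [ev|ev]; subst u' v' => //.
- by have := parT v mv; rewrite -(ext _ _ e) p_v (negPf p_u).
- by have := parT u mu; rewrite (ext _ _ e) p_u (negPf p_v).
- by move=> x; have := e (t x); rewrite /= tt.
Qed.

Lemma pbead_ext n c c' q : (0 < n)%N -> (forall i, (0 < i <= n)%N -> c i = c' i) ->
  pbead n c q = pbead n c' q.
Proof.
move=> n0 h; have [m [s [hs ->]]] := pos_rep q n0; rewrite !pbead_rep //.
by case: ltnP => sn; rewrite h //; lia.
Qed.

Lemma core_of_ext n k c c' : (0 < n)%N -> (forall i, (0 < i <= n)%N -> c i = c' i) ->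
  core_of n k c = core_of n k c'.
Proof.
move=> n0 h; rewrite /core_of; congr rows_of; apply: eq_map => t.
exact: pbead_ext.
Qed.

Lemma core_core_of n w c : (0 < n)%N -> mirrored n w -> levels n w c ->
  exists k0 : nat, forall k : nat, (k0 <= k)%N -> bounded n k c /\ core n w = core_of n k c.
Proof.
move=> n0 mw lw; have [k0 [h1 h2]] := core_levels n0 mw lw.
exists (k0 + 2)%N => k hk; split; last by apply: h2; lia.
by split=> [|i /h1]; lia.
Qed.

Lemma core_eq n u v c c' : (0 < n)%N -> mirrored n u -> mirrored n v ->
  levels n u c -> levels n v c' -> (forall i, (0 < i <= n)%N -> c i = c' i) ->
  core n u = core n v.
Proof.
move=> n0 mu mv lu lv h.
have [k hk] := core_core_of n0 mu lu; have [k' hk'] := core_core_of n0 mv lv.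
have [_ ->] := hk (k + k')%N ltac:(lia); have [_ ->] := hk' (k + k')%N ltac:(lia).
exact: core_of_ext.
Qed.

Lemma core_inj n u v c c' : (0 < n)%N -> mirrored n u -> mirrored n v ->
  levels n u c -> levels n v c' -> core n u = core n v ->
  forall i, (0 < i <= n)%N -> c i = c' i.
Proof.
move=> n0 mu mv lu lv e.
have [k hk] := core_core_of n0 mu lu; have [k' hk'] := core_core_of n0 mv lv.
have [[_ b1] e1] := hk (k + k')%N ltac:(lia).
have [[_ b2] e2] := hk' (k + k')%N ltac:(lia).
apply: (pbead_inj b1 b2) => q hq; apply: rows_of_pbead hq => //.
by rewrite -[LHS]/(core_of n (k + k') c) -e1 e.
Qed.

Lemma core_levels0 n w c : (0 < n)%N -> mirrored n w -> levels n w c ->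
  (forall i, (0 < i <= n)%N -> c i = 0) -> core n w = [::].
Proof.
move=> n0 mw lw h.
have [k /(_ k (leqnn k)) [_ ->]] := core_core_of n0 mw lw.
rewrite (core_of_ext _ n0 h) /core_of /psteps.
set K := (k * (2 * n))%N; have -> : (2 * K = K + K)%N by lia.
rewrite iotaD map_cat.
have neg (x : int) : pbead n (fun _ => 0) x = (x < 0).
  have [m [s [hs ->]]] := pos_rep x n0; rewrite pbead_rep //.
  rewrite oppr0; case: ltnP => _; apply/idP/idP => hm.
  - by have : 0 <= (- m - 1) * (2 * n)%:Z by [apply: mulr_ge0; lia]; lia.
  - by have : m * (2 * n)%:Z < 0 by [lia]; rewrite pmulr_llt0; lia.
  - by have : 0 <= (- m - 1) * (2 * n)%:Z by [apply: mulr_ge0; lia]; lia.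
  - by have : m * (2 * n)%:Z < 0 by [lia]; rewrite pmulr_llt0; lia.
have cst (b : bool) m l : [seq b | _ <- iota m l] = nseq l b.
  by elim: l m => //= l IH m; rewrite IH.
have -> : [seq pbead n (fun _ => 0) (t%:Z - K%:Z) | t <- iota 0 K] = nseq K true.
  by rewrite -(cst _ 0%N); apply/eq_in_map => t; rewrite mem_iota neg; lia.
have -> : [seq pbead n (fun _ => 0) (t%:Z - K%:Z) | t <- iota (0 + K) K] = nseq K false.
  by rewrite -(cst _ (0 + K)%N); apply/eq_in_map => t; rewrite mem_iota neg; lia.
by rewrite -[nseq K false]cat0s rows_of_pad.
Qed.

(** * Central peeling *)

Lemma actK ty n r c : (2 <= n)%N -> (r <= n)%N ->
  forall i, (0 < i <= n)%N -> act ty n r (act ty n r c) i = c i.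
Proof.
move=> n2 rn i hi; have E : (n == n.-1) = false by lia.
have E' : (n.-1 == n) = false by lia.
rewrite /act; have [_|r0] := eqVneq r 0%N.
  case: (uses_s0D ty) => /=.
    case: eqP => [->|i1] /=; first by lia.
    by case: eqP => [->|//] /=; lia.
  by case: eqP => [->|//]; lia.
have [_|rn'] := eqVneq r n.
  case: (uses_snD ty) => /=.
    case: eqP => [->|i1]; first by rewrite E eqxx opprK.
    by case: eqP => [->|//]; rewrite eqxx opprK.
  by case: eqP => [->|//]; rewrite eqxx opprK.
have E1 : (r.+1 == r) = false by lia.
case: eqP => [->|i1]; first by rewrite E1 eqxx.
by case: eqP => [->|//]; rewrite eqxx.
Qed.

Lemma coxeter_length_word ty n (rs : seq 'I_n.+1) c : (2 <= n)%N ->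
  levels n (word_prod ty rs) c -> (size rs)%:Z = ninv ty n c ->
  coxeter_length ty n (word_prod ty rs) (size rs).
Proof.
move=> n2 lc e; split; first by exists rs.
move=> ts et; have [h _] := word_length n2 (eq_levels lc (fsym et)).
by lia.
Qed.

Lemma word_min_coset_rep ty n (rs : seq 'I_n.+1) c : (2 <= n)%N ->
  levels n (word_prod ty rs) c -> (size rs)%:Z = ninv ty n c ->
  min_coset_rep ty n (word_prod ty rs).
Proof.
move=> n2 lc e; split; first exact: word_affine.
move=> x l l' px [_ hl] [[ts et <-] _].
apply: leq_trans (hl rs (frefl _)) _.
have lx := levels_right lc (parabolic_window n2 px).
by have [h _] := word_length n2 (eq_levels lx (fsym et)); lia.
Qed.

Lemma parabolic_id ty n : parabolic_group ty n id.
Proof. by exists [::]. Qed.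

Lemma peeling_exists ty n c : (min_rank ty <= n)%N ->
  (uses_s0D ty -> ~~ odd (level_sum n c)) ->
  exists (rs : seq 'I_n.+1) (U : seq cell),
  let la := core n (word_prod ty rs) in
  [/\ levels n (word_prod ty rs) c, (size rs)%:Z = ninv ty n c,
      central_peeling ty la rs U,
      uniq U /\ size U = size rs &
      forall b, b \in U -> (b.1 < ref_count ty la)%N \/
        b.1 = ref_count ty la /\ (b.2 <= row_len la (ref_count ty la))%N].
Proof.
move=> hn; have n2 := min_rank2 hn; have n0 : (0 < n)%N by lia.
have [m] := ubnP `|ninv ty n c|%N.
elim: m c => // m IH c hm par.
have := peel_exists n2 par; case=> [z|[p [r hp]]].
  exists [::], [::] => la.
  have lc : levels n id c by move=> i hi; exists i; rewrite ?z //; lia.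
  rewrite /la (core_levels0 n0 (mirrored_id n) lc z).
  split=> //; last exact: peeling_done.
  by rewrite (eq_ninv ty z) ninv0.
have rn := peel_le n2 hp.
pose r' := inord r : 'I_n.+1.
have r'E : r' = r :> nat by rewrite inordK.
pose c' := act ty n r c.
have inv' : ninv ty n c' = ninv ty n c - 1 by rewrite ninv_act // (peel_inv_step hn hp).
have g1 := ninv_ge0 ty n c; have g2 := ninv_ge0 ty n c'.
have par' : uses_s0D ty -> ~~ odd (level_sum n c').
  by move=> us; rewrite level_sum_act_odd //; apply: par.
have [rs [U [/= lc' sz pl [uU sU] bU]]] := IH c' ltac:(lia) par'.
have [mw' _ _] := word_affine ty rs n2.
have lc : levels n (word_prod ty (r' :: rs)) c.
  have := levels_gen ty r' n2 (mirrored_quasi mw') lc'; rewrite r'E.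
  move=> h i hi; have [j hj wj] := h i hi; exists j => //.
  by apply: etrans wj _; rewrite actK.
have [mw _ _] := word_affine ty (r' :: rs) n2.
have [k [[b1 e1] [b2 e2]]] : exists k,
    (bounded n k c /\ core n (word_prod ty (r' :: rs)) = core_of n k c) /\
    (bounded n k c' /\ core n (word_prod ty rs) = core_of n k c').
  have [k1 h1] := core_core_of n0 mw lc; have [k2 h2] := core_core_of n0 mw' lc'.
  by exists (k1 + k2)%N; split; [apply: h1 | apply: h2]; lia.
have [d0 pr] := @peeling_residue_core_of ty n k c p r r' hn par hp b1.
have [y [rec yle next]] := recorded_peel hn hp b1 b2.
rewrite -e1 in d0 pr rec yle next; rewrite -/c' -e2 in rec next.
set la := core n _ in d0 pr rec yle next; set mu := core n _ in rec next pl bU.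
set d := ref_count ty la in d0 pr rec yle next.
have szr : (size (r' :: rs))%:Z = ninv ty n c by rewrite /=; lia.
exists (r' :: rs), ((d, y) :: U) => /=; split=> //.
- rewrite -[_ :: U]/([:: (d, y)] ++ U) -rec -r'E.
  apply: (peeling_step (d := d) (mu := mu)) => //.
  + by move=> e; move: d0; rewrite /d /la e.
  + exact/pr.
  + exists (word_prod ty (r' :: rs)), (word_prod ty rs); split=> //.
    * exact: word_min_coset_rep lc szr.
    * exact: word_min_coset_rep lc' sz.
    * by exists id; [exact: parabolic_id | move=> x /=; rewrite genK].
- split; last by rewrite sU.
  rewrite uU andbT; apply/negP => /bU /=.
  by case: next => [|[-> lt]]; lia.
- move=> b; rewrite inE => /orP[/eqP -> /=|/bU]; first by right.
  by rewrite -/la -/d; case: next => [|[-> lt]]; lia.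
Qed.

Lemma core_act_levels ty n (r : 'I_n.+1) la mu : (2 <= n)%N -> core_act ty r la mu ->
  exists u v c, [/\ affine_group ty n u, levels n u c, core n u = la,
    mirrored n v & levels n v (act ty n r c) /\ core n v = mu].
Proof.
move=> n2 [u [v [[au _] [av _] cu cv [x px e]]]].
have [mu' _ _] := au; have [mv _ _] := av.
have [c lc] := mirrored_levels mu'; exists u, v, c; split=> //; split=> //.
have lu := levels_gen ty r n2 (mirrored_quasi mu') lc.
have [c' lc'] := mirrored_levels mv.
have lx := levels_right lc' (parabolic_window n2 px).
have mg := mirrored_comp (gen_mirrored ty r n2) mu'.
have h := levels_uniq (mirrored_quasi mg) (mirrored_inj mg) lu (eq_levels lx (fsym e)).
by move=> i hi; rewrite h //; apply: lc'.
Qed.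

Lemma core_act_functional ty n (r : 'I_n.+1) la mu mu' : (2 <= n)%N ->
  core_act ty r la mu -> core_act ty r la mu' -> mu = mu'.
Proof.
move=> n2 /(core_act_levels n2) [u [v [c [[m1 _ _] l1 e1 m2 [l2 <-]]]]].
move=> /(core_act_levels n2) [u' [v' [c' [[m1' _ _] l1' e1' m2' [l2' <-]]]]].
have n0 : (0 < n)%N by lia.
have h := core_inj n0 m1 m1' l1 l1' (etrans e1 (esym e1')).
apply: (core_eq n0 m2 m2' l2 l2') => i hi; have hr := ltn_ord r.
by rewrite /act; do ? case: eqP => ? //; do ? case: ifP => ?; rewrite !h //; lia.
Qed.

Lemma peeling_residue_functional ty n la mu (r r1 : 'I_n.+1) (d := ref_count ty la) :
  (min_rank ty <= n)%N -> la <> [::] ->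
  core_act ty r la mu -> peeling_residue ty n la (d, row_len la d) r ->
  peeling_residue ty n la (d, row_len la d) r1 -> r = r1.
Proof.
move=> hn la0; have n2 := min_rank2 hn; have n0 : (0 < n)%N by lia.
move=> /(core_act_levels n2) [u [v [c [au lc e _ _]]]].
have par := affine_parity au lc; have [mu' _ _] := au.
case: (peel_exists n2 par) => [z|[p [r0 hp]]].
  by case: la0; rewrite -e (core_levels0 n0 mu' lc z).
have [k /(_ k (leqnn k)) [bk ek]] := core_core_of n0 mu' lc.
rewrite /d -e ek => h1 h2; apply: val_inj => /=.
have [_ p1] := @peeling_residue_core_of ty n k c p r0 r hn par hp bk.
have [_ p2] := @peeling_residue_core_of ty n k c p r0 r1 hn par hp bk.
by rewrite (p1.1 h1) (p2.1 h2).
Qed.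

Lemma central_peeling_functional ty n la (rs rs' : seq 'I_n.+1) U U' :
  (min_rank ty <= n)%N -> central_peeling ty la rs U ->
  central_peeling ty la rs' U' -> rs' = rs /\ U' = U.
Proof.
move=> hn h; elim: h rs' U' => {la rs U} [|la mu d r rs U la0 dE d0 pr ca _ IH] rs' U' h'.
  by inversion h'.
inversion h' as [e|la' mu' d' r1 rs1 U1 _ dE' _ pr' ca' h1]; subst=> //.
have er : r = r1 by apply: peeling_residue_functional hn la0 ca pr pr'.
subst r1; have em := core_act_functional (min_rank2 hn) ca ca'; subst mu'.
by have [-> ->] := IH _ _ h1.
Qed.

Lemma eq_coxeter_length ty n w w' l : w =1 w' ->
  coxeter_length ty n w l -> coxeter_length ty n w' l.
Proof.
move=> e [[rs h1 h2] h3]; split; first by exists rs => // x; rewrite h1 e.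
by move=> ts h; apply: h3 => x; rewrite h e.
Qed.

Lemma coxeter_length_exists ty n (rs : seq 'I_n.+1) : exists l,
  coxeter_length ty n (word_prod ty rs) l.
Proof.
pose w := word_prod ty rs.
have qw (ts : seq 'I_n.+1) : quasi n (word_prod ty ts).
  elim: ts => [|t ts IH]; first exact: quasi_id.
  exact: quasi_comp (gen_quasi ty t) IH.
pose P l := [exists ts : l.-tuple 'I_n.+1, [forall k : 'I_n.+1, word_prod ty ts k%:Z == w k%:Z]].
have PP l (ts : seq 'I_n.+1) : word_prod ty ts =1 w -> size ts = l -> P l.
  move=> e <-; apply/existsP; exists (in_tuple ts); apply/forallP => k /=.
  by rewrite e.
have exP : exists l, P l by exists (size rs); apply: (PP _ rs).
case: (ex_minnP exP) => l /existsP [ts /forallP ets] lmin; exists l; split.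
  exists ts; last exact: size_tuple.
  apply: (quasi_ext (qw _) (qw _)) => k hk.
  have kn : (k < n.+1)%N by lia.
  exact/eqP/(ets (Ordinal kn)).
by move=> us e; apply: lmin; apply: PP e erefl.
Qed.

Theorem proposition6p2 (ty : quotient_type) (n : nat)
    (hn : (min_rank ty <= n)%N) (w : int -> int)
    (hw : min_coset_rep ty n w) :
  exists (rs : seq 'I_n.+1) (U : seq cell),
    [/\ central_peeling ty (core n w) rs U,
        forall (rs' : seq 'I_n.+1) (U' : seq cell),
          central_peeling ty (core n w) rs' U' -> rs' = rs /\ U' = U,
        reduced_expression ty rs w
      & coxeter_length ty n w (size (undup U))].
Proof.
have n2 := min_rank2 hn; have n0 : (0 < n)%N by lia.
have [aw minw] := hw; have [mw _ _] := aw.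
have [c lc] := mirrored_levels mw; have par := affine_parity aw lc.
have [rs [U [/= lv sz pl [uU sU] _]]] := peeling_exists hn par.
set v := word_prod ty rs in lv pl.
have av := word_affine ty rs n2; have [mv _ _] := av.
have sv : sorted_window ty n v by have [_] := word_length n2 lv; apply; rewrite sz.
have lenv := coxeter_length_word n2 lv sz.
have [xs [xs0 awx swx]] := sort_exists n2 aw.
have wx : w \o word_prod ty xs =1 v.
  apply: (sorted_unique n2 awx av _ lv swx sv).
  exact: levels_right lc (word_window ty n2 xs0).
have wE : word_prod ty (rs ++ rev xs) =1 w.
  move=> x; rewrite word_prod_cat /= -/v -wx /=.
  by rewrite word_prod_rev.
have [l hl] := coxeter_length_exists ty (rs ++ rev xs).
have {}hl := eq_coxeter_length wE hl.
have px : parabolic_group ty n (word_prod ty xs) by exists xs.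
have lle := minw _ _ _ px hl (eq_coxeter_length (fsym wx) lenv).
have [[ts et st] _] := hl.
have lt := eq_levels lc (fsym et).
have at_ := word_affine ty ts n2.
have st' : sorted_window ty n (word_prod ty ts).
  by have [_] := word_length n2 lt; apply; rewrite st -sz; lia.
have tv : word_prod ty ts =1 v by exact: (sorted_unique n2 at_ av lt lv st' sv).
have vw : v =1 w by move=> x; rewrite -tv et.
have ec : core n w = core n v by exact: (core_eq n0 mw mv lc lv).
have lenw := eq_coxeter_length vw lenv.
exists rs, U; rewrite ec; split=> //.
  by move=> rs' U' h'; exact: (central_peeling_functional hn pl h').
by rewrite (undup_id uU) sU.
Qed.
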